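(* Let $F$ be an infinitely generated free group, and let $\mathfrak{F}=\langle \operatorname{Aut}(F),F,S\rangle$ be the three-sorted structure described in the context. The structure $\langle\operatorname{Aut}(F),F,\mathcal{B}\rangle$ (with natural relations), where $\mathcal{B}$ is a free basis of $F$, is interpretable, with definable parameters, in the structure $\mathfrak{F}$ by means of first-order logic.
   Context: The sorts of $\mathfrak{F}$ are: the elements of $F$; the automorphisms of $F$; and the set $S$ of all free factors of $F$ (subgroups $A\le F$ such that $F=A*B$ for some subgroup $B\le F$). The basic relations of $\mathfrak{F}$ are: the group operations on $F$ and $\operatorname{Aut}(F)$; the actions of $\operatorname{Aut}(F)$ on $F$ and on $S$; membership between elements of $F$ and members of $S$; and the ternary relation $A=B*C$ on $S$. The natural relations of $\langle\operatorname{Aut}(F),F,\mathcal{B}\rangle$ are the group operations on $\operatorname{Aut}(F)$ and $F$, the action of $\operatorname{Aut}(F)$ on $F$, and the distinguished subset $\mathcal{B}\subseteq F$. ''Interpretable with definable parameters'' means: there are first-order formulas with parameters and a nonempty set of parameter tuples, definable without parameters in $\mathfrak{F}$, such that for every parameter tuple in this set the formulas define in $\mathfrak{F}$ (in the usual model-theoretic sense of interpretation) a structure isomorphic to $\langle\operatorname{Aut}(F),F,\mathcal{B}\rangle$. *)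

(* Defs.v *)
From HB Require Import structures.
From mathcomp Require Import all_boot monoid.
From mathcomp Require Import boolp classical_sets cardinality.

Set Implicit Arguments.
Unset Strict Implicit.
Unset Printing Implicit Defensive.

(* The tuples (x_1, ..., x_n) with x_i : T s_i, for l = [:: s_1; ...; s_n]. *)
Fixpoint stuple (S : Type) (T : S -> Type) (l : seq S) : Type :=
  if l is s :: l' then (T s * stuple T l')%type else unit.

Fixpoint stuple_cat (S : Type) (T : S -> Type) (l1 l2 : seq S) :
    stuple T l1 -> stuple T l2 -> stuple T (l1 ++ l2) :=
  match l1 with
  | [::] => fun _ y => y
  | s :: l1' => fun x y => (x.1, stuple_cat x.2 y)
  end.

Fixpoint stuple_map (S : Type) (T U : S -> Type) (f : forall s, T s -> U s)
    (l : seq S) : stuple T l -> stuple U l :=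
  match l with
  | [::] => fun x => x
  | s :: l' => fun x => (f s x.1, stuple_map f x.2)
  end.

Fixpoint stuple_flatten (S S' : Type) (T : S -> Type) (d : S' -> seq S)
    (l : seq S') :
    stuple (fun s => stuple T (d s)) l -> stuple T (flatten (map d l)) :=
  match l with
  | [::] => fun x => x
  | s :: l' => fun x => stuple_cat x.1 (stuple_flatten x.2)
  end.

Fixpoint stuple_all (S : Type) (T : S -> Type) (P : forall s, T s -> Prop)
    (l : seq S) : stuple T l -> Prop :=
  match l with
  | [::] => fun _ => True
  | s :: l' => fun x => P s x.1 /\ stuple_all P x.2
  end.

Fixpoint stuple_all2 (S : Type) (T U : S -> Type)
    (P : forall s, T s -> U s -> Prop) (l : seq S) :
    stuple T l -> stuple U l -> Prop :=
  match l with
  | [::] => fun _ _ => True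
  | s :: l' => fun x y => P s x.1 y.1 /\ stuple_all2 P x.2 y.2
  end.

(* Signatures are relational: an operation is represented by its graph. *)
Record signature := Signature {
  ssort : Type;
  rsym : Type;
  arity : rsym -> seq ssort
}.

Record structure (L : signature) := Structure {
  carrier :> ssort L -> Type;
  interp : forall r : rsym L, stuple carrier (arity r) -> Prop
}.

Definition isomorphic (L : signature) (M N : structure L) : Prop :=
  exists2 f : forall s, M s -> N s,
    forall s, bijective (f s) &
    forall (r : rsym L) (x : stuple M (arity r)),
      interp x <-> interp (stuple_map f x).

(* De Bruijn variables of sort s in a context of sorted free variables. *)
Inductive var (S : Type) : seq S -> S -> Type :=
  | VZ l s : var (s :: l) s
  | VS l s t : var l s -> var (t :: l) s.

Fixpoint lookup (S : Type) (T : S -> Type) (l : seq S) (s : S)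
    (v : var l s) : stuple T l -> T s :=
  match v with
  | VZ _ _ => fun e => e.1
  | VS _ _ _ v' => fun e => lookup v' e.2
  end.

Inductive formula (L : signature) : seq (ssort L) -> Type :=
  | Eq l s : var l s -> var l s -> formula l
  | Rel l (r : rsym L) : stuple (var l) (arity r) -> formula l
  | Not l : formula l -> formula l
  | And l : formula l -> formula l -> formula l
  | Or l : formula l -> formula l -> formula l
  | Imp l : formula l -> formula l -> formula l
  | All l s : formula (s :: l) -> formula l
  | Ex l s : formula (s :: l) -> formula l.

Fixpoint sat (L : signature) (M : structure L) (l : seq (ssort L))
    (phi : formula l) : stuple M l -> Prop :=
  match phi with
  | Eq _ _ v w => fun e => lookup v e = lookup w e
  | Rel _ r vs => fun e => interp (stuple_map (fun s v => lookup v e) vs)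
  | Not _ p => fun e => ~ sat p e
  | And _ p q => fun e => sat p e /\ sat q e
  | Or _ p q => fun e => sat p e \/ sat q e
  | Imp _ p q => fun e => sat p e -> sat q e
  | All _ s p => fun e => forall x : M s, sat p (x, e)
  | Ex _ s p => fun e => exists x : M s, sat p (x, e)
  end.

(* An element of sort s of the K-structure is represented by tuples of sorts
   [i_dim s]; the last block of free variables is the parameter tuple. *)
Record interpretation (L K : signature) := Interpretation {
  i_par : seq (ssort L);
  i_dim : ssort K -> seq (ssort L);
  i_dom : forall s, formula (i_dim s ++ i_par);
  i_eqv : forall s, formula (i_dim s ++ i_dim s ++ i_par);
  i_rel : forall r : rsym K, formula (flatten (map i_dim (arity r)) ++ i_par)
}.

Section Interpreted.
Variables (L K : signature) (I : interpretation L K).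
Variables (M : structure L) (p : stuple M (i_par I)).

Definition itup (s : ssort K) : Type := stuple M (i_dim I s).

Definition in_dom (s : ssort K) (x : itup s) : Prop :=
  sat (i_dom I s) (stuple_cat x p).

Definition in_eqv (s : ssort K) (x y : itup s) : Prop :=
  sat (i_eqv I s) (stuple_cat x (stuple_cat y p)).

Definition in_rel (r : rsym K) (x : stuple itup (arity r)) : Prop :=
  sat (i_rel I r) (stuple_cat (stuple_flatten x) p).

Definition well_defined : Prop :=
  [/\ forall s (x : itup s), in_dom x -> in_eqv x x,
      forall s (x y : itup s), in_dom x -> in_dom y -> in_eqv x y -> in_eqv y x,
      forall s (x y z : itup s), in_dom x -> in_dom y -> in_dom z ->
        in_eqv x y -> in_eqv y z -> in_eqv x z
    & forall (r : rsym K) (x y : stuple itup (arity r)),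
        stuple_all in_dom x -> stuple_all in_dom y -> stuple_all2 in_eqv x y ->
        (in_rel x <-> in_rel y)].

Definition eqv_class (s : ssort K) (x : itup s) : set (itup s) :=
  [set y | in_dom y /\ in_eqv x y].

Definition quotient (s : ssort K) : Type :=
  {C : set (itup s) | exists2 x, in_dom x & C = eqv_class x}.

Definition interpreted : structure K :=
  @Structure K quotient (fun r (C : stuple quotient (arity r)) =>
    exists2 x : stuple itup (arity r),
      stuple_all2 (fun s (y : itup s) (D : quotient s) => sval D y) x C &
      in_rel x).

End Interpreted.

Definition interpretable_with_definable_parameters (L K : signature)
    (N : structure K) (M : structure L) : Prop :=
  exists (I : interpretation L K) (pi : formula (i_par I)),
    (exists p : stuple M (i_par I), sat pi p) /\
    (forall p : stuple M (i_par I), sat pi p ->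
       well_defined p /\ isomorphic (interpreted p) N).

Local Open Scope group_scope.
Local Open Scope classical_set_scope.

Section Groups.
Variable F : groupType.

Definition subgroup (A : set F) : Prop :=
  [/\ A 1, forall x y, A x -> A y -> A (x * y) & forall x, A x -> A x^-1].

Definition infinitely_generated : Prop :=
  ~ exists2 X : set F, finite_set X & smallest subgroup X = setT.

(* The letter (b, x) stands for x^-1 if b, and for x otherwise. *)
Definition letter (u : bool * F) : F := if u.1 then u.2^-1 else u.2.

Definition reduced_word (B : set F) (w : seq (bool * F)) : Prop :=
  (forall u, u \in w -> B u.2) /\
  sorted (fun u v => ~~ ((u.2 == v.2) && (u.1 != v.1))) w.

Definition free_basis (B : set F) : Prop :=
  forall x : F, exists! w, reduced_word B w /\ \prod_(u <- w) letter u = x.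

Definition free_group : Prop := exists B : set F, free_basis B.

(* The syllable (b, x) is a nontrivial element of C if b, and of B otherwise;
   consecutive syllables come from different factors. *)
Definition reduced_product (B C : set F) (w : seq (bool * F)) : Prop :=
  (forall u, u \in w -> u.2 <> 1 /\ (if u.1 then C u.2 else B u.2)) /\
  sorted (fun u v => u.1 != v.1) w.

(* A = B * C, as an internal free product of subgroups (normal form). *)
Definition free_product (A B C : set F) : Prop :=
  [/\ subgroup A, subgroup B, subgroup C
    & forall x : F, A x <->
        exists! w, reduced_product B C w /\ \prod_(u <- w) u.2 = x].

Definition free_factor (A : set F) : Prop :=
  exists B : set F, free_product setT A B.

Definition automorphism (f : F -> F) : Prop :=
  bijective f /\ {morph f : x y / x * y}.

Definition Aut : Type := {f : F -> F | automorphism f}.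

Definition FreeFactors : Type := {A : set F | free_factor A}.

Definition aut_fun (f : Aut) : F -> F := sval f.
Coercion aut_fun : Aut >-> Funclass.

(* The graph of multiplication in Aut(F), with (f g)(x) = f(g(x)). *)
Definition rel_mul_aut (f g h : Aut) : Prop := forall x, f (g x) = h x.

Definition rel_one_aut (f : Aut) : Prop := forall x, f x = x.

Definition rel_inv_aut (f g : Aut) : Prop := forall x, f (g x) = x.

Definition rel_mul (x y z : F) : Prop := x * y = z.

Definition rel_one (x : F) : Prop := x = 1.

Definition rel_inv (x y : F) : Prop := x^-1 = y.

Definition rel_act (f : Aut) (x y : F) : Prop := f x = y.

Definition rel_act_fac (f : Aut) (A B : FreeFactors) : Prop :=
  f @` sval A = sval B.

Definition rel_mem (x : F) (A : FreeFactors) : Prop := sval A x.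

Definition rel_free_product (A B C : FreeFactors) : Prop :=
  free_product (sval A) (sval B) (sval C).

End Groups.

Inductive fsort := FAut | FElt | FFac.

Inductive frel :=
  | FMulAut | FOneAut | FInvAut | FMul | FOne | FInv
  | FActElt | FActFac | FMem | FFreeProd.

Definition frel_arity (r : frel) : seq fsort :=
  match r with
  | FMulAut => [:: FAut; FAut; FAut]
  | FOneAut => [:: FAut]
  | FInvAut => [:: FAut; FAut]
  | FMul => [:: FElt; FElt; FElt]
  | FOne => [:: FElt]
  | FInv => [:: FElt; FElt]
  | FActElt => [:: FAut; FElt; FElt]
  | FActFac => [:: FAut; FFac; FFac]
  | FMem => [:: FElt; FFac]
  | FFreeProd => [:: FFac; FFac; FFac]
  end.

Definition fsig : signature := Signature frel_arity.

Definition fcarrier (F : groupType) (s : fsort) : Type :=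
  match s with FAut => Aut F | FElt => F | FFac => FreeFactors F end.

Definition finterp (F : groupType) (r : frel) :
    stuple (fcarrier F) (frel_arity r) -> Prop :=
  match r return stuple (fcarrier F) (frel_arity r) -> Prop with
  | FMulAut => fun '(f, (g, (h, _))) => rel_mul_aut f g h
  | FOneAut => fun '(f, _) => rel_one_aut f
  | FInvAut => fun '(f, (g, _)) => rel_inv_aut f g
  | FMul => fun '(x, (y, (z, _))) => rel_mul x y z
  | FOne => fun '(x, _) => rel_one x
  | FInv => fun '(x, (y, _)) => rel_inv x y
  | FActElt => fun '(f, (x, (y, _))) => rel_act f x y
  | FActFac => fun '(f, (A, (B, _))) => rel_act_fac f A B
  | FMem => fun '(x, (A, _)) => rel_mem x A
  | FFreeProd => fun '(A, (B, (C, _))) => rel_free_product A B C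
  end.

Definition fstructure (F : groupType) : structure fsig :=
  @Structure fsig (fcarrier F) (@finterp F).

Inductive bsort := BAut | BElt.

Inductive brel :=
  | BMulAut | BOneAut | BInvAut | BMul | BOne | BInv | BActElt | BBasis.

Definition brel_arity (r : brel) : seq bsort :=
  match r with
  | BMulAut => [:: BAut; BAut; BAut]
  | BOneAut => [:: BAut]
  | BInvAut => [:: BAut; BAut]
  | BMul => [:: BElt; BElt; BElt]
  | BOne => [:: BElt]
  | BInv => [:: BElt; BElt]
  | BActElt => [:: BAut; BElt; BElt]
  | BBasis => [:: BElt]
  end.

Definition bsig : signature := Signature brel_arity.

Definition bcarrier (F : groupType) (s : bsort) : Type :=
  match s with BAut => Aut F | BElt => F end.

Definition binterp (F : groupType) (B : set F) (r : brel) :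
    stuple (bcarrier F) (brel_arity r) -> Prop :=
  match r return stuple (bcarrier F) (brel_arity r) -> Prop with
  | BMulAut => fun '(f, (g, (h, _))) => rel_mul_aut f g h
  | BOneAut => fun '(f, _) => rel_one_aut f
  | BInvAut => fun '(f, (g, _)) => rel_inv_aut f g
  | BMul => fun '(x, (y, (z, _))) => rel_mul x y z
  | BOne => fun '(x, _) => rel_one x
  | BInv => fun '(x, (y, _)) => rel_inv x y
  | BActElt => fun '(f, (x, (y, _))) => rel_act f x y
  | BBasis => fun '(x, _) => B x
  end.

Definition bstructure (F : groupType) (B : set F) : structure bsig :=
  @Structure bsig (bcarrier F) (binterp B).

(* Main.v *)
From HB Require Import structures.
Require Import Defs.
From mathcomp Require Import all_boot monoid.
From mathcomp Require Import boolp classical_sets functions cardinality.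

(* Parameters: automorphisms rho, tau and free factors A, C with F = A * C and
   tau(A) = C. Let G be the set of d <> 1 in A with rho(d) = d tau(d); the coded
   basis is G together with tau(G). If w is a nonempty reduced word over G, then
   the normal form of rho(w) in A * C never collapses, because adjacent syllables
   only merge to d^-1 d' or tau(d d'^-1) with d <> d'. Hence G is always
   independent, and so is the union of G and tau(G).

   That G generates A is expressed by coding the prefixes of a word. For each x in
   A there are automorphisms lam and psi attaching to elements e of tau(G) a label
   y = e^-1 lam(e) <> 1 and a value z = e^-1 psi(e), such that x is a value and
   each value is either 1 or differs by a letter of G from the value at an element
   whose label is a square root of y. Squaring increases the length of nontrivial
   elements, so every value is a finite product of letters.

   Conversely, if F has basis {b_i, c_i}, take A = <b_i>, C = <c_i>,
   rho(b_i) = b_i c_i, rho(c_i) = c_i, and let tau exchange b_i and c_i; then G is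
   {b_i}. All free bases of F have the same cardinality, so every coded basis is
   the image of B under an automorphism of F. *)

Set Implicit Arguments.
Unset Strict Implicit.
Unset Printing Implicit Defensive.
Local Open Scope group_scope.
Local Open Scope classical_set_scope.

(** * Words over a subset of a group *)

(** Shared by letter words, with [g] equal to [linv], and by syllable words, with [g] inverting the
    element. Since [g] reverses [e], sortedness can only fail at the seam. *)
Lemma sorted_rev_map_cat (T : eqType) (e : rel T) (g : T -> T) x s y s' :
    (forall u v, e (g v) (g u) = e u v) ->
    sorted e (x :: s) -> sorted e (y :: s') -> e (g x) y ->
  sorted e (rev (map g (x :: s)) ++ y :: s').
Proof.
move=> eg xs ys gxy; rewrite rev_cons cat_rcons sorted_cat_cons /= gxy /=.
rewrite /= in ys; rewrite ys andbT -rev_cons rev_sorted -map_cons sorted_map.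
by rewrite (@eq_sorted _ _ e) // => u v /=; rewrite eg.
Qed.

Lemma morph_group1V (F : groupType) (f : F -> F) : {morph f : x y / x * y} ->
  f 1 = 1 /\ {morph f : x / x^-1}.
Proof.
move=> fM; have f1 : f 1 = 1 by apply: (@mulgI F (f 1)); rewrite -fM !mulg1.
by split=> // x; apply: (@mulgI F (f x)); rewrite -fM !mulgV.
Qed.

Section Words.
Variable F : groupType.
Implicit Types (B : set F) (u v : bool * F) (w : seq (bool * F)) (f : F -> F).

Definition linv u : bool * F := (~~ u.1, u.2).

Definition compatible u v := ~~ ((u.2 == v.2) && (u.1 != v.1)).

Definition word_over B w := forall u, u \in w -> B u.2.

Definition wprod w := \prod_(u <- w) letter u.

Definition subst f w := [seq (u.1, f u.2) | u <- w].

Definition winv w := rev (map linv w).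

Lemma letter_linv u : letter (linv u) = (letter u)^-1.
Proof. by case: u => [[] x]; rewrite /letter //= invgK. Qed.

Lemma compatible_linv u v : compatible (linv v) (linv u) = compatible u v.
Proof. by rewrite /compatible /= eq_sym; case: u v => [[] ?] [[] ?]. Qed.

Lemma compatible_linvl u v : compatible (linv u) v = (u != v).
Proof. case: u v => [a x] [b y]; rewrite /compatible /= -[(a, x) == _]/((a == b) && (x == y)).
by case: a b => [] []; rewrite ?andbT ?andbF. Qed.

Lemma incompatible_letter u v : ~~ compatible u v -> v = linv u.
Proof.
case: u v => [a x] [b y]; rewrite negbK /= => /andP[/eqP-> ab].
by rewrite /linv /=; move: a b ab => [] [].
Qed.

Lemma wprod_nil : wprod [::] = 1. Proof. exact: big_nil. Qed.
Lemma wprod_cons u w : wprod (u :: w) = letter u * wprod w.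
Proof. exact: big_cons. Qed.
Lemma wprod_cat w w' : wprod (w ++ w') = wprod w * wprod w'.
Proof. exact: big_cat. Qed.

Lemma wprod_inv w : wprod (winv w) = (wprod w)^-1.
Proof.
elim: w => [|u w IH]; rewrite /winv /= ?wprod_nil ?invg1 //.
by rewrite rev_cons -cats1 wprod_cat IH !wprod_cons wprod_nil mulg1 letter_linv invgM.
Qed.

Lemma wprod_subst f w : {morph f : x y / x * y} ->
  wprod (subst f w) = f (wprod w).
Proof.
move=> fM; have [f1 fV] := morph_group1V fM.
elim: w => [|u w IH]; rewrite /= ?wprod_nil ?f1 // !wprod_cons fM -IH.
by case: u => [[] x] //=; rewrite /letter /= fV.
Qed.

Lemma over_cons B u w : word_over B (u :: w) <-> B u.2 /\ word_over B w.
Proof.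
split=> [h|[hu hw] v]; last by rewrite inE => /predU1P[->|/hw].
by split=> [|v vw]; apply: h; rewrite inE ?eqxx // vw orbT.
Qed.

Lemma over_cat B w w' :
  word_over B (w ++ w') <-> word_over B w /\ word_over B w'.
Proof.
split=> [h|[h h'] u]; last by rewrite mem_cat => /orP[/h|/h'].
by split=> u uw; apply: h; rewrite mem_cat uw ?orbT.
Qed.

Lemma over_winv B w : word_over B w -> word_over B (winv w).
Proof. by move=> h u; rewrite mem_rev => /mapP[v /h ? ->]. Qed.

Lemma over_subst f B w : word_over B w -> word_over (f @` B) (subst f w).
Proof. by move=> h u /mapP[v /h ? ->]; exists v.2. Qed.

Lemma reduced_cons B u w : reduced_word B (u :: w) -> reduced_word B w.
Proof. by move=> [/over_cons[_ hw] /path_sorted]. Qed.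

(** Each step cancels neighbours [u] and [linv u], and these still cancel after any renaming [f] of
    the generators, so one reduced word serves all [f] at once. This makes [free_basis_extension]
    well defined. *)
Lemma reduction B w : word_over B w ->
  exists2 w', reduced_word B w' &
    forall f, wprod (subst f w') = wprod (subst f w).
Proof.
elim: w => [|u w IH]; first by exists [::].
move=> /over_cons[Bu /IH[w' [Bw' sw'] ew']].
have uw' f : letter (u.1, f u.2) * wprod (subst f w') = wprod (subst f (u :: w)).
  by rewrite ew' -wprod_cons.
case: w' => [|v w''] in Bw' sw' ew' uw' *.
  exists [:: u] => // [|f]; last by rewrite -uw' -wprod_cons.
  by split=> //; apply/over_cons; split.
have [uv|/incompatible_letter ev] := boolP (compatible u v).
  exists [:: u, v & w''] => [|f]; last by rewrite -uw' -wprod_cons.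
  by split; [apply/over_cons | rewrite /= -/(compatible u v) uv].
exists w''; first exact: (@reduced_cons _ v).
move=> f; rewrite -uw' ev /= wprod_cons mulgA.
by rewrite (letter_linv (u.1, f u.2)) mulgV mul1g.
Qed.

Lemma subst_id w : subst id w = w.
Proof. by rewrite -[RHS]map_id; apply: eq_map => -[]. Qed.

Lemma reduction_id B w : word_over B w ->
  exists2 w', reduced_word B w' & wprod w' = wprod w.
Proof. by move=> /reduction[w' rw' /(_ id)]; rewrite !subst_id; exists w'. Qed.

Definition independent B := forall w, reduced_word B w -> wprod w = 1 -> w = [::].

Definition generated B : set F := [set x | exists2 w, word_over B w & wprod w = x].

Lemma reduced_cat_inv B u w v w' : reduced_word B (u :: w) ->
  reduced_word B (v :: w') -> u != v -> reduced_word B (winv (u :: w) ++ v :: w').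
Proof.
move=> [h s] [h' s'] uv; split; first by apply/over_cat; split=> //; exact: over_winv.
by apply: (@sorted_rev_map_cat _ compatible linv) => //;
  [exact: compatible_linv | rewrite compatible_linvl].
Qed.

(** Common first letters are stripped. At the first difference, [winv w ++ w'] is reduced and
    nonempty but has value 1, against independence. *)
Lemma independent_inj B w w' : independent B -> reduced_word B w ->
  reduced_word B w' -> wprod w = wprod w' -> w = w'.
Proof.
move=> iB; elim: w w' => [|u w IH] [|v w'] rw rw' e //.
- by have := iB _ rw'; rewrite -e wprod_nil => /(_ erefl).
- by have := iB _ rw; rewrite e wprod_nil => /(_ erefl).
have [uv|uv] := eqVneq u v.
  rewrite uv; congr cons; apply: IH.
  - exact: reduced_cons rw.
  - exact: reduced_cons rw'.
  by apply: (@mulgI _ (letter u)); rewrite {2}uv -!wprod_cons.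
have := iB _ (reduced_cat_inv rw rw' uv).
rewrite wprod_cat wprod_inv e mulVg => /(_ erefl) /(congr1 size) /eqP.
by rewrite size_cat /= addnS.
Qed.

Lemma free_basisP B :
  free_basis B <-> generated B = setT /\ independent B.
Proof.
split=> [fB|[gB iB] x].
  split=> [|w rw ew].
    by rewrite -subTset => x _; have [w [[[? _] <-] _]] := fB x; exists w.
  have [w' [_ uw']] := fB 1.
  by rewrite -(uw' w) // -(uw' [::]) //; split=> //; exact: wprod_nil.
have [w0 ow <-] : generated B x by rewrite gB.
have [w rw ew] := reduction_id ow.
exists w; split=> // w' [rw' ew']; apply: (independent_inj iB) => //.
by rewrite ew -ew'.
Qed.

End Words.

(** * Lengths of squares *)

Section Squares.
Variable F : groupType.
Implicit Types (B : set F) (u v : bool * F) (w : seq (bool * F)) (f : F -> F).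

Lemma linvK : involutive (@linv F).
Proof. by case=> a x; rewrite /linv negbK. Qed.

Lemma winv_cat w w' : winv (w ++ w') = winv w' ++ winv w.
Proof. by rewrite /winv map_cat rev_cat. Qed.

Lemma winvK : involutive (@winv F).
Proof. by move=> w; rewrite /winv map_rev revK mapK //; exact: linvK. Qed.

Lemma size_winv w : size (winv w) = size w.
Proof. by rewrite size_rev size_map. Qed.

Lemma compatible_linvr u : compatible u (linv u) = false.
Proof. by case: u => [[] x]; rewrite /compatible /= eqxx. Qed.

Lemma sorted_winv_cat w : sorted (@compatible F) (w ++ winv w) -> w = [::].
Proof.
case: w / lastP => // w u; rewrite /winv map_rcons rev_rcons cat_rcons.
by rewrite sorted_cat_cons /= compatible_linvr andbF.
Qed.

(** Letters are peeled off on both sides of the seam until it is compatible; [c] collects what has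
    cancelled. *)
Lemma cancellation w w' :
    sorted (@compatible F) w -> sorted (@compatible F) w' ->
  exists a b c, [/\ w = a ++ c, w' = winv c ++ b & sorted (@compatible F) (a ++ b)].
Proof.
elim: w' w => [|v w' IH] w sw sw'.
  by exists w, [::], [::]; rewrite !cats0.
case: w / lastP sw => [_|w u sw]; first by exists [::], (v :: w'), [::].
have [uv|/incompatible_letter ev] := boolP (compatible u v).
  exists (rcons w u), (v :: w'), [::]; rewrite cats0; split=> //.
  by rewrite cat_rcons sorted_cat_cons sw /= uv.
move: sw; rewrite -cats1 => /cat_sorted2[sw _].
have [a [b [c [-> -> sab]]]] := IH w sw (path_sorted sw').
exists a, b, (c ++ [:: u]); split=> //; first by rewrite catA.
by rewrite winv_cat ev.
Qed.

(** First and last letters of such a word are mutually inverse, so stripping both leaves a shorter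
    word of the same kind. A single letter is never its own inverse, and an empty middle would leave
    two cancelling neighbours. *)
Lemma winv_fixed w : sorted (@compatible F) w -> winv w = w -> w = [::].
Proof.
have [n] := ubnP (size w); elim: n w => // n IH [//|u w] /= lt_wn.
case: w / lastP lt_wn => [_ _ [/esym/eqP]|w v]; first by case: u => -[].
rewrite size_rcons => lt_wn sw; rewrite -cats1 -cat1s !winv_cat /= => -[evu].
move=> /eqP; rewrite eqseq_cat ?size_winv // => /andP[/eqP ew _].
have w0 : w = [::].
  apply: IH => //; first exact: ltnW.
  by move: sw => /path_sorted; rewrite -cats1 => /cat_sorted2[].
by move: sw; rewrite w0 /= -evu -[X in compatible _ X]linvK compatible_linvr.
Qed.

(* If [w w] collapses to length at most [|w|], more than half of [w] cancels,
   so the middle part of [w] is its own inverse. *)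
Lemma size_square B w w' : independent B -> reduced_word B w -> w <> [::] ->
  reduced_word B w' -> wprod w' = wprod w * wprod w -> size w < size w'.
Proof.
move=> iB [ow sw] w0 rw' ew'; have [a [b [c [ewa ewc sab]]]] := cancellation sw sw.
have -> : w' = a ++ b.
  apply: (independent_inj iB) => //.
    split=> //; apply/over_cat; move: (ow) (ow).
    by rewrite {1}ewa ewc => /over_cat[? _] /over_cat[].
  by rewrite ew' {1}ewa ewc !wprod_cat wprod_inv mulgA mulgK.
rewrite ltnNge size_cat; apply/negP => le_abw; apply: w0.
have sz : size w = (size a + size c)%N by rewrite ewa size_cat.
have sz' : size w = (size c + size b)%N by rewrite ewc size_cat size_winv.
have eab : size b = size a by apply/eqP; rewrite -(eqn_add2l (size c)) -sz' sz addnC.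
rewrite eab sz leq_add2l in le_abw.
have eac : take (size a) (winv c) = a.
  rewrite -[RHS](take_size_cat c (erefl (size a))) -ewa ewc takel_cat ?size_winv // take_size_cat.
pose m := drop (size a) (winv c).
have em : winv c = a ++ m by rewrite -[LHS](cat_take_drop (size a)) eac.
(* Both sides spell [w], once as [a ++ c] and once as [winv c ++ b]. *)
have : a ++ (winv m ++ winv a) = a ++ (m ++ b).
  by rewrite -winv_cat -em winvK -ewa ewc em catA.
move=> /eqP; rewrite eqseq_cat // eqxx /= eqseq_cat ?size_winv // => /andP[/eqP mm /eqP eb].
have m0 : m = [::].
  apply: winv_fixed => //; move: sw; rewrite ewc em -catA => /cat_sorted2[_].
  by move=> /cat_sorted2[].
have a0 : a = [::] by apply: sorted_winv_cat; rewrite eb.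
by rewrite ewc em m0 a0 -eb a0.
Qed.

End Squares.

(** * Free products *)

Section Generated.
Variable F : groupType.
Implicit Types (B : set F) (f : F -> F).

Lemma subgroup_generated B : subgroup (generated B).
Proof.
split=> [|x y [w ow <-] [w' ow' <-]|x [w ow <-]].
- by exists [::] => //; exact: wprod_nil.
- by exists (w ++ w'); [apply/over_cat | exact: wprod_cat].
- by exists (winv w); [exact: over_winv | exact: wprod_inv].
Qed.

Lemma sub_generated B : B `<=` generated B.
Proof.
move=> x Bx; exists [:: (false, x)]; first by move=> u; rewrite inE => /eqP->.
by rewrite wprod_cons wprod_nil mulg1.
Qed.

Lemma generated_sub B H : subgroup H -> B `<=` H -> generated B `<=` H.
Proof.
move=> [H1 HM HV] BH x [w ow <-]; elim: w ow => [_|u w IH].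
  by rewrite wprod_nil.
move=> /over_cons[/BH Hu /IH Hw]; rewrite wprod_cons; apply: HM => //.
by rewrite /letter; case: u.1 => //; exact: HV.
Qed.

Lemma generated_image f B : {morph f : x y / x * y} ->
  generated (f @` B) = f @` generated B.
Proof.
move=> fM; have [f1 fV] := morph_group1V fM; have [g1 gM gV] := subgroup_generated B.
apply/seteqP; split=> [|_ [_ [w ow <-] <-]].
  apply: generated_sub => [|_ [x Bx <-]]; last first.
    by exists x => //; exact: sub_generated.
  split=> [|_ _ [x gx <-] [y gy <-]|_ [x gx <-]].
  - by exists 1.
  - by exists (x * y) => //; exact: gM.
  - by exists x^-1 => //; exact: gV.
by exists (subst f w); [exact: over_subst | rewrite wprod_subst].
Qed.

Lemma independent_image f B : {morph f : x y / x * y} -> injective f ->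
  independent B -> independent (f @` B).
Proof.
move=> fM fI iB w [ow sw] ew; have [f1 _] := morph_group1V fM.
have [w' ow' ew'] : exists2 w', word_over B w' & w = subst f w'.
  elim: w ow {sw ew} => [|[e y] w IH]; first by exists [::].
  move=> /over_cons[[x Bx /= <-] /IH[w' ow' ->]].
  by exists ((e, x) :: w') => //; apply/over_cons.
rewrite ew' (iB w') //; last by apply: fI; rewrite f1 -wprod_subst // -ew'.
split=> //; move: sw; rewrite ew' sorted_map; apply: sub_sorted => u v.
by rewrite /= (inj_eq fI).
Qed.
End Generated.

Section FreeProducts.
Variable F : groupType.
Implicit Types (A B C X Y : set F) (v : seq (bool * F)).

Definition sprod v := \prod_(u <- v) u.2.

Lemma sprod_nil : sprod [::] = 1. Proof. exact: big_nil. Qed.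
Lemma sprod_cons a v : sprod (a :: v) = a.2 * sprod v. Proof. exact: big_cons. Qed.
Lemma sprod_cat v v' : sprod (v ++ v') = sprod v * sprod v'. Proof. exact: big_cat. Qed.

(** Trivial elements are allowed here, unlike in [reduced_product], so that syllables of one
    subgroup are closed under products. *)
Definition syllable A C (a : bool * F) := if a.1 then C a.2 else A a.2.

Lemma reduced_product_cons A C a v : reduced_product A C (a :: v) <->
  [/\ a.2 <> 1, syllable A C a, (if v is b :: _ then a.1 != b.1 else true) &
      reduced_product A C v].
Proof.
split=> [[h s]|[a1 Aa av [h s]]].
  have [a1 Aa] := h a (mem_head _ _); split=> //; first by case: v s {h} => //= b v /andP[].
  split; last exact: path_sorted s.
  by move=> b bv; apply: h; rewrite inE bv orbT.
split; last by case: v av s {h} => //= b v -> ->.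
by move=> b; rewrite inE => /predU1P[->|/h].
Qed.

Definition sinv v := rev [seq (a.1, a.2^-1) | a <- v].

Lemma sprod_inv v : sprod (sinv v) = (sprod v)^-1.
Proof.
elim: v => [|a v IH]; rewrite /sinv /= ?sprod_nil ?invg1 //.
by rewrite rev_cons -cats1 sprod_cat IH !sprod_cons sprod_nil mulg1 invgM.
Qed.

Lemma free_product_nontrivial A C v : free_product setT A C ->
  reduced_product A C v -> sprod v = 1 -> v = [::].
Proof.
move=> [_ _ _ fp] rv ev; have [w' [_ uw']] := (fp 1).1 I.
by rewrite -(uw' v) // -(uw' [::]) //; split=> //; exact: sprod_nil.
Qed.

Section Intro.
Variables (A C : set F) (sA : subgroup A) (sC : subgroup C).
Hypothesis nontriv : forall v, reduced_product A C v -> sprod v = 1 -> v = [::].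

Lemma syllableM s x y : syllable A C (s, x) -> syllable A C (s, y) -> syllable A C (s, x * y).
Proof. by case: sA sC => [_ ? _] [_ ? _]; case: s; rewrite /syllable /=; auto. Qed.

Lemma syllableV s x : syllable A C (s, x) -> syllable A C (s, x^-1).
Proof. by case: sA sC => [_ _ ?] [_ _ ?]; case: s; rewrite /syllable /=; auto. Qed.

Lemma syllable_reduction v : (forall a, a \in v -> syllable A C a) ->
  exists2 v', reduced_product A C v' & sprod v' = sprod v.
Proof.
elim: v => [|[s x] v IH] h; first by exists [::].
have [|v' rv' ev'] := IH; first by move=> a av; apply: h; rewrite inE av orbT.
have {h} sx := h _ (mem_head _ _).
rewrite sprod_cons /= -{}ev'; have [->|/eqP x1] := eqVneq x 1; first by exists v'; rewrite ?mul1g.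
case: v' rv' => [|[s' y] v'] rv'.
  by exists [:: (s, x)]; rewrite ?sprod_cons //; apply/reduced_product_cons.
have [es|ss'] := eqVneq s s'; last first.
  by exists [:: (s, x), (s', y) & v']; rewrite ?sprod_cons //; apply/reduced_product_cons.
move: rv'; rewrite -es => /reduced_product_cons[/= y1 sy av' rv'].
have [xy|/eqP xy] := eqVneq (x * y) 1.
  by exists v' => //; rewrite sprod_cons mulgA xy mul1g.
exists ((s, x * y) :: v'); last by rewrite !sprod_cons mulgA.
by apply/reduced_product_cons; split=> //; apply: syllableM.
Qed.

Lemma reduced_sinv_cat a v b v' : reduced_product A C (a :: v) ->
  reduced_product A C (b :: v') -> a.1 != b.1 ->
  reduced_product A C (sinv (a :: v) ++ b :: v').
Proof.
move=> [h s] [h' s'] ab; split.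
  move=> c; rewrite mem_cat mem_rev => /orP[|/h' //] /mapP[d /h[d1 Ad] ->] /=.
  split; last exact: (@syllableV d.1 d.2).
  by move/eqP; rewrite invg_eq1 => /eqP.
apply: (@sorted_rev_map_cat _ (fun u v : bool * F => u.1 != v.1)
  (fun a : bool * F => (a.1, a.2^-1))) => //.
by move=> c d /=; rewrite eq_sym.
Qed.

(** As for words, a difference at the head yields a nonempty reduced product of value 1. Distinct
    heads in the same factor merge to [x^-1 * y], which is then compared with the tail [v], whose
    head, if any, lies in the other factor. *)
Lemma reduced_product_inj v v' : reduced_product A C v -> reduced_product A C v' ->
  sprod v = sprod v' -> v = v'.
Proof.
elim: v v' => [|[s x] v IH] [|[s' y] v'] rv rv' e //.
- by have := nontriv rv'; rewrite -e sprod_nil => /(_ erefl).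
- by have := nontriv rv; rewrite e sprod_nil => /(_ erefl).
have [es|ss'] := eqVneq s s'; last first.
  have := nontriv (reduced_sinv_cat rv rv' ss').
  rewrite sprod_cat sprod_inv e mulVg => /(_ erefl) /(congr1 size) /eqP.
  by rewrite size_cat /= addnS.
rewrite -{s'}es in rv' e *.
have [/= x1 sx av {}rv] := (reduced_product_cons _ _ _ _).1 rv.
have [/= y1 sy av' {}rv'] := (reduced_product_cons _ _ _ _).1 rv'.
rewrite !sprod_cons /= in e.
have [exy|/eqP xy] := eqVneq x y.
  by rewrite exy (IH v') //; apply: (mulgI x); rewrite {2}exy.
have rxy : reduced_product A C ((s, x^-1 * y) :: v').
  apply/reduced_product_cons; split=> //=.
    by move=> /mulg1_eq; rewrite invgK.
  by apply: syllableM => //; apply: syllableV.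
have exy : sprod ((s, x^-1 * y) :: v') = sprod v.
  by rewrite sprod_cons -mulgA -e mulKg.
case: v av rv exy {e IH} => [_ _|a v sa rv] exy.
  by have := nontriv rxy; rewrite exy sprod_nil => /(_ erefl).
have := nontriv (reduced_sinv_cat rv rxy _).
rewrite eq_sym sa sprod_cat sprod_inv exy mulVg => /(_ isT erefl) /(congr1 size) /eqP.
by rewrite size_cat /= addnS.
Qed.

Lemma free_productI : (forall x, exists2 v, (forall a, a \in v -> syllable A C a) &
    sprod v = x) -> free_product setT A C.
Proof.
move=> gen; split=> //.
move=> x; split=> // _; have [v0 /syllable_reduction[v rv <-] <-] := gen x.
exists v; split=> // v' [rv' ev']; exact: reduced_product_inj.
Qed.

End Intro.

Lemma free_product_gen A C H : free_product setT A C -> subgroup H ->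
  A `<=` H -> C `<=` H -> H = setT.
Proof.
move=> [_ _ _ fp] [H1 HM _] AH CH; rewrite -subTset => x _.
have [v [[[hv _] <-] _]] := (fp x).1 I; rewrite -/(sprod v).
elim: v hv => [|a v IH] hv; first by rewrite sprod_nil.
rewrite sprod_cons; apply: HM; last by apply: IH => b bv; apply: hv; rewrite inE bv orbT.
by have [_] := hv a (mem_head _ _); case: a.1 => [/CH|/AH].
Qed.

(** * Normal forms of [rho] on words over group-like elements *)

Section Comultiplication.
Variables (A C : set F) (fp : free_product setT A C) (rho tau : F -> F).
Hypotheses (rhoM : {morph rho : x y / x * y}) (tauM : {morph tau : x y / x * y}).
Hypotheses (tauI : injective tau) (tauC : forall x, A x -> C (tau x)).
Variable X : set F.
Hypothesis XA : X `<=` A.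
Hypothesis X1 : forall d, X d -> d <> 1.
Hypothesis rhoX : forall d, X d -> rho d = d * tau d.

(* The head of the normal form is tracked explicitly: prepending a letter merges at
   most two syllables, which cannot cancel as the word is reduced. *)
Lemma comultiplication_word u w : reduced_word X (u :: w) ->
  exists2 v, reduced_product A C ((u.1, if u.1 then (tau u.2)^-1 else u.2) :: v) &
    sprod ((u.1, if u.1 then (tau u.2)^-1 else u.2) :: v) = rho (wprod (u :: w)).
Proof.
have [tau1 tauV] := morph_group1V tauM; have [rho1 rhoV] := morph_group1V rhoM.
have [_ sA sC _] := fp.
have [[A1 AM AV] [C1 CM CV]] := (sA, sC).
have V1 (x : F) : x <> 1 -> x^-1 <> 1 by move=> x1 /eqP; rewrite invg_eq1 => /eqP.
have tX1 d : X d -> tau d <> 1 by move=> /X1 d1; rewrite -tau1 => /tauI.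
elim: w u => [|u2 w IH] [e d] [/over_cons[/= Xd ow] sw].
  rewrite wprod_cons wprod_nil mulg1; case: e {sw}; rewrite /letter /=.
    exists [:: (false, d^-1)]; last by rewrite !sprod_cons sprod_nil mulg1 rhoV rhoX ?invgM.
    do !apply/reduced_product_cons; split=> //=; [exact/V1/tX1|exact/CV/tauC/XA|].
    by apply/reduced_product_cons; split=> //=; [exact/V1/X1 | exact/AV/XA].
  exists [:: (true, tau d)]; last by rewrite !sprod_cons sprod_nil mulg1 rhoX.
  apply/reduced_product_cons; split=> //=; [exact: X1|exact: XA|].
  by apply/reduced_product_cons; split=> //=; [exact: tX1 | exact/tauC/XA].
have [|v rv ev] := IH u2; first by split=> //; move: sw => /= /andP[].
have Xd2 : X u2.2 by have /over_cons[] := ow.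
rewrite [wprod (_ :: u2 :: w)]wprod_cons rhoM -ev.
move: sw => /= /andP[+ _]; case: u2 {IH ow} => [[] d2] /= in rv ev Xd2 *; case: e.
- move=> _; exists [:: (false, d^-1), (true, (tau d2)^-1) & v]; last first.
    by rewrite /letter /= !sprod_cons /= rhoV rhoX // invgM !mulgA.
  apply/reduced_product_cons; split=> //=; [exact/V1/tX1|exact/CV/tauC/XA|].
  by apply/reduced_product_cons; split=> //=; [exact/V1/X1 | exact/AV/XA].
- rewrite negb_and orbF /= => /eqP dd2.
  have [/= _ sd2 av rv'] := (reduced_product_cons _ _ _ _).1 rv.
  exists ((true, tau d * (tau d2)^-1) :: v); last first.
    by rewrite /letter /= !sprod_cons /= rhoX // !mulgA.
  apply/reduced_product_cons; split=> //=; [exact: X1|exact: XA|].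
  apply/reduced_product_cons; split=> //=; last by apply: CM => //; exact/tauC/XA.
  by rewrite -tauV -tauM -tau1 => /tauI /divg1_eq.
- rewrite negb_and orbF /= => /eqP dd2.
  have [/= _ sd2 av rv'] := (reduced_product_cons _ _ _ _).1 rv.
  exists ((false, d^-1 * d2) :: v); last first.
    by rewrite /letter /= !sprod_cons /= rhoV rhoX // invgM !mulgA.
  apply/reduced_product_cons; split=> //=; [exact/V1/tX1|exact/CV/tauC/XA|].
  apply/reduced_product_cons; split=> //=; last by apply: AM => //; exact/AV/XA.
  by move=> /mulg1_eq; rewrite invgK.
- move=> _; exists [:: (true, tau d), (false, d2) & v]; last first.
    by rewrite /letter /= !sprod_cons /= rhoX // !mulgA.
  apply/reduced_product_cons; split=> //=; [exact: X1|exact: XA|].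
  by apply/reduced_product_cons; split=> //=; [exact: tX1 | exact/tauC/XA].
Qed.

(** If a nonempty reduced word had value 1, so would its image under [rho], whose normal form has at
    least one syllable. *)
Lemma comultiplication_independent : independent X.
Proof.
move=> [//|u w] rw e; have [v rv ev] := comultiplication_word rw.
have [rho1 _] := morph_group1V rhoM.
by have := free_product_nontrivial fp rv; rewrite ev e rho1 => /(_ erefl).
Qed.

(** The product [x * tau x] has two syllables, and the normal form from [comultiplication_word]
    starts according to the first letter of the word for [x]. Uniqueness of normal forms makes that
    letter positive and equal to [x]. *)
Lemma comultiplication_primitive x : generated X x -> x <> 1 ->
  rho x = x * tau x -> X x.
Proof.
move=> [w0 /reduction_id[w rw <-] <-] {w0} x1 rx.
case: w rw x1 rx => [|u w] rw x1 rx; first by rewrite wprod_nil in x1.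
have [_ sA sC _] := fp.
have [v rv ev] := comultiplication_word rw.
have Ax : A (wprod (u :: w)).
  by apply: (generated_sub sA XA); exists (u :: w) => //; case: rw.
set y := wprod (u :: w) in x1 rx Ax ev *.
have [tau1 _] := morph_group1V tauM.
have rv2 : reduced_product A C [:: (false, y); (true, tau y)].
  apply/reduced_product_cons; split=> //=.
  by apply/reduced_product_cons; split=> //=; [rewrite -tau1 => /tauI | exact: tauC].
have := reduced_product_inj sA sC (fun v => free_product_nontrivial fp) rv rv2.
rewrite ev rx !sprod_cons sprod_nil mulg1 => /(_ erefl) [-> <- _].
by case: rw => /over_cons[].
Qed.

End Comultiplication.

(** A reduced word over the union splits into runs of letters from one side. Independence of that
    side makes each run a nontrivial syllable, so the runs form a reduced product. *)
Lemma independentU A C X Y : free_product setT A C -> X `<=` A -> Y `<=` C ->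
  independent X -> independent Y -> independent (X `|` Y).
Proof.
move=> fp XA YC iX iY; pose side (u : bool * F) := ~~ `[< X u.2 >].
have [_ sA sC _] := fp.
have block u p q : reduced_word (X `|` Y) (u :: p ++ q) ->
    all (fun u' => side u' == side u) p ->
    wprod (u :: p) <> 1 /\ syllable A C (side u, wprod (u :: p)).
  rewrite -cat_cons => -[/over_cat[oup _] /cat_sorted2[sup _]] ap.
  have {}ap u' : u' \in u :: p -> side u' = side u.
    by rewrite inE => /predU1P[->//|/(allP ap)/eqP].
  have [su|su] := boolP (side u).
    have {}oup : word_over Y (u :: p).
      move=> u' hu'; case: (oup _ hu') => // /asboolP.
      by have := ap _ hu'; rewrite su /side => /negbTE->.
    split; first by move=> /iY-/(_ (conj oup sup)).
    by apply: (generated_sub sC YC); exists (u :: p).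
  have {}oup : word_over X (u :: p).
    by move=> u' hu'; have := ap _ hu'; rewrite (negbTE su) /side => /negbFE/asboolP.
  split; first by move=> /iX-/(_ (conj oup sup)).
  by apply: (generated_sub sA XA); exists (u :: p).
(* [p] continues the leading run begun by [u], and [v] lists the values of the later runs. *)
suff main u w : reduced_word (X `|` Y) (u :: w) -> exists p q v,
    [/\ w = p ++ q, all (fun u' => side u' == side u) p,
       reduced_product A C ((side u, wprod (u :: p)) :: v) & sprod v = wprod q].
  move=> [//|u w] rw; have [p [q [v [ew _ rv ev]]]] := main u w rw.
  have := free_product_nontrivial fp rv.
  by rewrite sprod_cons ev -wprod_cat cat_cons ew => /[apply].
elim: w u => [|u2 w IH] u rw.
  exists [::], [::], [::]; split; rewrite ?sprod_nil ?wprod_nil //.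
  by have [//|? ?] := block u [::] [::] rw; apply/reduced_product_cons.
have [p [q [v [ew ap rv ev]]]] := IH u2 (reduced_cons rw).
have [su|su] := eqVneq (side u) (side u2).
  exists (u2 :: p), q, v; split=> //; rewrite /= ?su ?ew ?eqxx //.
  have [/= _ _ av rv'] := (reduced_product_cons _ _ _ _).1 rv.
  have [||b1 sb] := block u (u2 :: p) q; first by rewrite cat_cons -ew.
    by rewrite /= su eqxx.
  by apply/reduced_product_cons; split=> //; rewrite -su.
exists [::], (u2 :: w), ((side u2, wprod (u2 :: p)) :: v); split=> //.
  by have [//|? ?] := block u [::] (u2 :: w) rw; apply/reduced_product_cons.
by rewrite sprod_cons ev -wprod_cat cat_cons ew.
Qed.

End FreeProducts.

Local Open Scope card_scope.

(** * Automorphisms and cardinality of free bases *)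

Lemma inj_card_le_fun (T U : Type) (A : set T) (B : set U) (f : T -> U) :
  set_fun A B f -> {in A &, injective f} -> A #<= B.
Proof.
move=> fAB fI; rewrite -(card_le_eql (inj_card_eq fI)).
by apply: subset_card_le => _ [x Ax <-]; exact: fAB.
Qed.

Section Cardinality.
Variables (T : pointedType) (X : set T).
Hypothesis infX : infinite_set X.

(* A maximal family [G] of disjoint sequences in [X] leaves out only finitely
   many elements, so [X] injects into [G * nat]. *)
Lemma infinite_setX_nat : X `*` [set: nat] #<= X.
Proof.
pose P (G : set (nat -> T)) := (forall s, G s -> injective s /\ forall k, X (s k)) /\
  (forall s s' k k', G s -> G s' -> s k = s' k' -> s = s').
have [|G [[GX Gd] Gmax]] := @Zorn_bigcup _ P.
  move=> Fam FamP tot; split=> [s [G FG Gs]|s s' k k' [G FG Gs] [G' FG' Gs']].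
    exact: (FamP _ FG).1.
  by have [/(_ _ Gs) Hs|/(_ _ Gs') Hs'] := tot _ _ FG FG';
    [apply: (FamP _ FG').2|apply: (FamP _ FG).2].
pose R : set T := [set x | X x /\ forall s k, G s -> s k <> x].
have finR : finite_set R.
  apply: contrapT => /infiniteP/pcard_leP[s].
  have sR k : R (s k) by apply: funS.
  have sI : injective s by move=> k k' /inj; apply; rewrite inE.
  apply: (Gmax ((s : nat -> T) |` G)).
    split=> [s' Gs'|]; first by right.
    move=> sub; have : G s by apply: sub; left.
    by move=> /(fun Gs => (sR 0%N).2 s 0%N Gs); apply.
  split=> [s' [->|/GX //]|s1 s2 k k' [->|G1] [->|G2] //].
  - by split=> // k; have [] := sR k.
  - by move=> e; have [_ /(_ s2 k' G2)] := sR k; rewrite e.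
  - by move=> e; have [_ /(_ s1 k G1)] := sR k'; rewrite e.
  - exact: Gd.
have [s0 Gs0] : G !=set0.
  apply/set0P/eqP => G0; apply: infX; apply: sub_finite_set finR => x Xx.
  by split=> // s k; rewrite G0.
have /pcard_injP[r rI] : R #<= [set: nat] by exact: finite_set_countable.
(* Each element of [X] receives a sequence of the family, a tag and a number. Leftover elements
   share [s0] and are numbered by [r] under the tag [true]; the others record their own place. *)
have /choice[rep repP] (x : T) : exists p : (nat -> T) * (bool * nat), X x ->
    G p.1 /\ (if p.2.1 then R x /\ p.2.2 = r x else x = p.1 p.2.2).
  have [Rx|nRx] := pselect (R x); first by exists (s0, (true, r x)).
  have [[s [k [Gs <-]]]|no] := pselect (exists s k, G s /\ s k = x).
    by exists (s, (false, k)).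
  exists (s0, (true, 0%N)) => Xx; case: nRx; split=> // s k Gs skx.
  by apply: no; exists s, k.
(* Tag, number and [n] are packed into one position. Disjointness of the family recovers the
   sequence from a value, and injectivity of the sequence recovers the position. *)
pose h (xn : T * nat) := (rep xn.1).1 (pickle ((rep xn.1).2, xn.2)).
have hX : set_fun (X `*` [set: nat]) X h.
  by move=> [x n] [/= /repP[/GX[_ GXx] _] _]; exact: GXx.
apply: (inj_card_le_fun hX).
  move=> [x n] [y m]; rewrite !inE /h => -[/= /repP[Gx ex] _] [/= /repP[Gy ey] _] e.
  have es := Gd _ _ _ _ Gx Gy e; move: e ex ey; rewrite es => /(GX _ Gy).1.
  move=> /(pcan_inj pickleK) [-> ->].
case: ifP => _ ex ey; congr pair; last exact: etrans ex (esym ey).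
by case: ex ey => Rx rx [Ry ry]; apply: rI; rewrite ?inE // -rx -ry.
Qed.

End Cardinality.

(** * Universal property, shears and equicardinality of free bases *)

Section FreeBases.
Variable F : groupType.
Implicit Types (B D : set F) (f g : F -> F).

(** Makes [infinite_setX_nat], stated for pointed types, applicable to subsets of [F]. *)
#[non_forgetful_inheritance]
HB.instance Definition _ := isPointed.Build F 1.

Lemma generated_morph_eq B f g : {morph f : x y / x * y} -> {morph g : x y / x * y} ->
  generated B = setT -> (forall x, B x -> f x = g x) -> f = g.
Proof.
move=> fM gM gB fg; apply/funext => x.
have [w ow <-] : generated B x by rewrite gB.
rewrite -!wprod_subst //; congr wprod; apply/eq_in_map => u uw.
by rewrite fg //; exact: ow.
Qed.

Lemma free_basis_word B : free_basis B ->
  exists word : F -> seq (bool * F),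
    forall x, reduced_word B (word x) /\ wprod (word x) = x.
Proof.
move=> fB; suff /choice[word ?] : forall x, exists w, reduced_word B w /\ wprod w = x.
  by exists word.
by move=> x; have [w [? _]] := fB x; exists w.
Qed.

(** The image of [x] is obtained by substituting [f] in its reduced word. By [reduction] every other
    word over [B] for [x] gives the same value, so concatenating words yields multiplicativity. *)
Lemma free_basis_extension B f : free_basis B ->
  exists2 g, {morph g : x y / x * y} & forall x, B x -> g x = f x.
Proof.
move=> fB; have [word wordP] := free_basis_word fB.
have gE w : word_over B w -> wprod (subst f (word (wprod w))) = wprod (subst f w).
  move=> /reduction[w' rw' ew']; rewrite -ew'; congr (wprod (subst f _)).
  have [rw ew] := wordP (wprod w); have [_ iB] := (free_basisP B).1 fB.
  by apply: (independent_inj iB) => //; rewrite ew -[w']subst_id -[w in LHS]subst_id ew'.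
exists (fun x => wprod (subst f (word x))) => [x y|x Bx].
  have [[[ox _] ex] [[oy _] ey]] := (wordP x, wordP y).
  rewrite -{1}ex -{1}ey -wprod_cat gE; last exact/over_cat.
  by rewrite /subst map_cat wprod_cat.
have := gE [:: (false, x)]; rewrite wprod_cons wprod_nil mulg1 => ->.
  by rewrite wprod_cons wprod_nil mulg1.
by move=> u; rewrite inE => /eqP->.
Qed.

(** One composite is the identity on [B] and the other on [D], hence both are the identity on the
    group generated. *)
Lemma free_basis_inverse B D f f' g g' : free_basis B -> free_basis D ->
    {morph g : x y / x * y} -> {morph g' : x y / x * y} ->
    (forall x, B x -> g x = f x) -> (forall x, D x -> g' x = f' x) ->
    (forall x, B x -> g' (f x) = x) -> (forall x, D x -> g (f' x) = x) ->
  automorphism g.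
Proof.
move=> /free_basisP[gB _] /free_basisP[gD _] gM g'M gE g'E fK f'K.
split=> //; exists g' => x.
  rewrite -[RHS]/(id x) -[LHS]/((g' \o g) x); congr (_ x).
  apply: generated_morph_eq gB _ => [y z|y z|y By] //=; first by rewrite gM g'M.
  by rewrite gE // fK.
rewrite -[RHS]/(id x) -[LHS]/((g \o g') x); congr (_ x).
apply: generated_morph_eq gD _ => [y z|y z|y By] //=; first by rewrite g'M gM.
by rewrite g'E // f'K.
Qed.

Lemma free_basis_bij B D f f' : free_basis B -> free_basis D ->
    (forall x, B x -> D (f x) /\ f' (f x) = x) ->
    (forall x, D x -> B (f' x) /\ f (f' x) = x) ->
  exists g : Aut F, forall x, B x -> g x = f x.
Proof.
move=> fB fD fBD fDB; have [g gM gE] := free_basis_extension f fB.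
have [g' g'M g'E] := free_basis_extension f' fD.
suff ag : automorphism g by exists (exist _ g ag).
apply: (free_basis_inverse fB fD gM g'M gE g'E) => x.
  by move=> /fBD[Dx ex]; rewrite g'E.
by move=> /fDB[Dx ex]; rewrite gE.
Qed.

(** The inverse sends [x] to [x * (t x)^-1]: both maps fix [t x], a word in basis elements on which
    [t] is trivial. The automorphisms [rho], [lam] and [psi] of [coding_exists] are such shears. *)
Lemma free_basis_shear B (t : F -> F) : free_basis B ->
    (forall x, B x -> generated [set y | B y /\ t y = 1] (t x)) ->
  exists g : Aut F, forall x, B x -> g x = x * t x.
Proof.
move=> fB tfix; have [g gM gE] := free_basis_extension (fun x => x * t x) fB.
have [g' g'M g'E] := free_basis_extension (fun x => x * (t x)^-1) fB.
suff ag : automorphism g by exists (exist _ g ag).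
have [[g1 gV] [g'1 g'V]] := (morph_group1V gM, morph_group1V g'M).
have fixed k x : {morph k : x y / x * y} -> (forall y, B y -> t y = 1 -> k y = y) ->
    B x -> k (t x) = t x.
  move=> kM kfix /tfix[w ow <-]; rewrite -wprod_subst // -[in RHS](subst_id w).
  congr wprod; apply/eq_in_map => u /ow[Bu tu].
  by rewrite kfix.
apply: (free_basis_inverse fB fB gM g'M gE g'E) => x Bx.
  rewrite g'M g'E // (fixed g') ?mulgVK // => y By ty.
  by rewrite g'E // ty invg1 mulg1.
rewrite gM gV gE // (fixed g) ?mulgK // => y By ty.
by rewrite gE // ty mulg1.
Qed.

Lemma free_basis_infinite B : infinitely_generated F -> free_basis B -> infinite_set B.
Proof.
move=> infF /free_basisP[gB _] finB; apply: infF; exists B => //.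
apply/seteqP; split=> // x _ H [sH BH]; apply: (generated_sub sH BH).
by rewrite gB.
Qed.

(** Every [b] in [B] occurs in the [B]-word of some [d] in [D], so [b] is determined by [d] and a
    position; this injects [B] into pairs of an element of [D] and a number. *)
Lemma free_basis_card_le B D : free_basis B -> free_basis D -> infinite_set D ->
  B #<= D.
Proof.
move=> fB fD infD; apply: card_le_trans (infinite_setX_nat infD).
have [word wordP] := free_basis_word fB.
have [gD _] := (free_basisP D).1 fD; have [gB iB] := (free_basisP B).1 fB.
have /choice[r rP] (b : F) : exists p : F * nat, B b ->
    D p.1 /\ b = nth 1 (map snd (word p.1)) p.2.
  have [Bb|nBb] := pselect (B b); last by exists (1, 0%N).
  apply: contrapT => no.
  have nob d : D d -> b \notin map snd (word d).
    move=> Dd; apply/negP => bd; apply: no.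
    by exists (d, index b (map snd (word d))) => _; rewrite nth_index.
  (* Killing [b] and fixing the rest of [B] would fix [D] pointwise, hence be the identity, so that
     [b = 1]. *)
  have [g gM gE] := free_basis_extension (fun x => if x == b then 1 else x) fB.
  have gid : g = id.
    apply: generated_morph_eq gD _ => // d Dd.
    have [[ow _] ew] := wordP d; rewrite -[in RHS]ew -[in LHS]ew -wprod_subst //.
    congr wprod; rewrite -[RHS]subst_id; apply/eq_in_map => u uw.
    rewrite gE; last exact: ow.
    by case: eqP => // ub; have := nob _ Dd; rewrite -ub map_f.
  have b1 : b = 1 by rewrite -[b]/(id b) -gid gE // eqxx.
  have := iB [:: (false, 1)]; rewrite wprod_cons wprod_nil mulg1 => H.
  suff // : [:: (false, 1 : F)] = [::] by [].
  by apply: H => //; split=> // u; rewrite inE => /eqP->; rewrite -b1.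
apply: (@inj_card_le_fun _ _ _ _ r) => [b /rP[]|b b'] //.
by rewrite !inE => /rP[_ eb] /rP[_ eb'] e; rewrite eb eb' e.
Qed.

Lemma free_basis_aut B D : infinitely_generated F -> free_basis B -> free_basis D ->
  exists g : Aut F, g @` B = D.
Proof.
move=> infF fB fD; have [infB infD] := (free_basis_infinite infF fB, free_basis_infinite infF fD).
have /card_set_bijP[f [fBD fI fS]] : B #= D.
  by rewrite card_eq_le !free_basis_card_le.
have /choice[f' f'P] (y : F) : exists x, D y -> B x /\ f x = y.
  have [Dy|nDy] := pselect (D y); last by exists y.
  by have [x Bx <-] := fS y Dy; exists x.
have [||g gE] := @free_basis_bij B D f f' fB fD; last first.
- exists g; apply/seteqP; split=> [_ [x Bx <-]|y /f'P[Bx <-]].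
    by rewrite /= gE //; exact: fBD.
  by exists (f' y) => //; rewrite gE.
- exact: f'P.
  move=> x Bx; split; first exact: fBD.
  by have [|Bx' e] := f'P (f x) ; [exact: fBD | apply: fI; rewrite ?inE].
Qed.

Lemma infinite_set_double B : infinite_set B -> exists h : bool * F -> F,
  set_bij (setT `*` B) B h.
Proof.
move=> infB; suff /card_set_bijP[h ?] : [set: bool] `*` B #= B by exists h.
rewrite card_eq_le; apply/andP; split.
  apply: card_le_trans (infinite_setX_nat infB).
  apply: (@inj_card_le_fun _ _ _ _ (fun sx : bool * F => (sx.2, nat_of_bool sx.1))).
    by move=> [s x] [].
  by move=> [[] x] [[] y] _ _ [] // ->.
by apply: (@inj_card_le_fun _ _ _ _ (fun x => (true, x))) => [x Bx|x y _ _ [//]].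
Qed.

End FreeBases.

(** * Coding a basis by automorphisms and free factors *)

Section Coding.
Variable F : groupType.
Implicit Types (rho tau lam psi : Aut F) (A B C : set F).

(** [rho] plays the part of a comultiplication from [A] to [A * C], with [tau] identifying [A] with
    [C]; these are its group-like elements. *)
Definition grouplike rho tau A : set F :=
  [set d | A d /\ d <> 1 /\ rho d = d * tau d].

Definition coded_basis rho tau A : set F :=
  grouplike rho tau A `|` tau @` grouplike rho tau A.

(** [lam e <> e] says that the label of [e] is nontrivial, which is what makes repeated square roots
    of labels terminate. *)
Definition marked rho tau A lam : set F :=
  [set e | (exists d, grouplike rho tau A d /\ tau d = e) /\ lam e <> e].

(* [y] and [y * y] are the labels of [e'] and [e], [z] and [z'] their values. *)
Definition prefix_step rho tau A lam psi (e e' : F) : Prop :=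
  exists y z z' d,
    [/\ lam e' = e' * y, lam e = e * (y * y), psi e' = e' * z, psi e = e * z' &
        grouplike rho tau A d /\ (z * d = z' \/ z' * d = z)].

Definition prefix_chain rho tau A lam psi : Prop := forall e,
  marked rho tau A lam e -> psi e = e \/
  exists e', marked rho tau A lam e' /\ prefix_step rho tau A lam psi e e'.

Definition coding rho tau A C : Prop :=
  [/\ free_product setT A C, tau @` A = C &
      forall x, A x -> exists lam psi, prefix_chain rho tau A lam psi /\
        exists e, marked rho tau A lam e /\ psi e = e * x].

Lemma aut_morph (f : Aut F) : {morph f : x y / x * y}.
Proof. by have [] := svalP f. Qed.

Lemma aut_inj (f : Aut F) : injective f.
Proof. by have [/bij_inj] := svalP f. Qed.

(** Induction on the length, over an arbitrary basis [B], of the label [e^-1 * lam e]: the label of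
    [e'] is a square root of it, hence shorter by [size_square]. *)
Lemma prefix_chain_generated B rho tau A lam psi e x : free_basis B ->
  prefix_chain rho tau A lam psi -> marked rho tau A lam e -> psi e = e * x ->
  generated (grouplike rho tau A) x.
Proof.
move=> fB ch; have [word wordP] := free_basis_word fB.
have [_ iB] := (free_basisP B).1 fB.
have [G1 GM GV] := subgroup_generated (grouplike rho tau A).
have [n] := ubnP (size (word (e^-1 * lam e))); elim: n e x => // n IH e x.
rewrite ltnS => le_en me ee; have [|[e' [me']]] := ch e me.
  by rewrite ee -[RHS]mulg1 => /mulgI->.
move=> [y [z [z' [d [le' le pe' pe [Gd zd]]]]]].
have {x ee} -> : x = z' by apply: (mulgI e); rewrite -ee.
have Gz : generated (grouplike rho tau A) z.
  apply: (IH e') => //; apply: leq_trans le_en.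
  rewrite le le' !mulKg; have [[ry ey] [ryy eyy]] := (wordP y, wordP (y * y)).
  apply: (size_square iB ry _ ryy); last by rewrite ey.
  by move=> y0; apply: (me'.2); rewrite le' -ey y0 wprod_nil mulg1.
have {}Gd := sub_generated Gd.
case: zd => [<-|zd]; first exact: GM.
by rewrite -[z'](mulgK d) zd; apply: GM => //; exact: GV.
Qed.

(** The chains give [A = generated G], and [tau] carries this to [C], so the two halves generate
    [F]. Independence of [G] comes from the comultiplication, passes to its image under [tau], and
    then to the union by [independentU]. *)
Lemma coding_free_basis B rho tau A C : free_basis B -> coding rho tau A C ->
  free_basis (coded_basis rho tau A).
Proof.
move=> fB [fp tauA chains]; set G := grouplike rho tau A.
have [_ sA sC _] := fp.
have GA : G `<=` A by move=> d [].
have tauC x : A x -> C (tau x) by move=> Ax; rewrite -tauA; exists x.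
have AG : A = generated G.
  apply/seteqP; split; last exact: generated_sub.
  by move=> x /chains[lam [psi [ch [e [me]]]]]; exact: prefix_chain_generated me.
have CG : C = generated (tau @` G).
  by rewrite generated_image -?AG //; exact: aut_morph.
have iG : independent G.
  apply: (comultiplication_independent fp (aut_morph rho) (aut_morph tau)) => //.
  - exact: aut_inj.
  - by move=> d [_ []].
  - by move=> d [_ []].
apply/free_basisP; split.
  apply: (free_product_gen fp); first exact: subgroup_generated.
    rewrite {1}AG; apply: generated_sub; first exact: subgroup_generated.
    by move=> x Gx; apply: sub_generated; left.
  rewrite CG; apply: generated_sub; first exact: subgroup_generated.
  by move=> x Gx; apply: sub_generated; right.
apply: (independentU fp) => //; first by rewrite CG; exact: sub_generated.
by apply: independent_image => //; [exact: aut_morph | exact: aut_inj].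
Qed.

End Coding.

(** * Existence of a coding *)

Section Existence.
Variable F : groupType.
Implicit Types (X Y : set F).

Lemma independent_neq1 X x : independent X -> X x -> x <> 1.
Proof.
move=> iX Xx x1; have := iX [:: (false, x)].
rewrite wprod_cons wprod_nil mulg1 => H.
suff // : [:: (false, x)] = [::] by [].
by apply: H => //; split=> // u; rewrite inE => /eqP->.
Qed.

Lemma independent_expg X x n : independent X -> X x -> x ^+ n = 1 -> n = 0%N.
Proof.
move=> iX Xx xn; have := iX (nseq n (false, x)).
have -> : wprod (nseq n (false, x)) = x ^+ n.
  by elim: n {xn} => [|n IH]; rewrite ?wprod_nil //= wprod_cons IH expgS.
rewrite xn => H; suff : nseq n (false, x) = [::] by case: n {xn H}.
apply: H => //; split; first by move=> u /nseqP[-> _].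
by case: n {xn} => //= n; elim: n => //= n ->; rewrite eqxx.
Qed.

Lemma reduced_word_cat X Y p u w : X `&` Y = set0 -> reduced_word X p ->
  reduced_word (X `|` Y) (u :: w) -> Y u.2 -> reduced_word (X `|` Y) (p ++ u :: w).
Proof.
move=> XY0 [op sp] [ow sw] Yu; split.
  by apply/over_cat; split=> // v /op; left.
case: p / lastP op sp => // p v op sp.
rewrite cat_rcons sorted_cat_cons sp /=; rewrite /= in sw; rewrite sw andbT.
apply/negP => /andP[/eqP vu _].
have : (X `&` Y) u.2 by split=> //; rewrite -vu; apply: op; rewrite mem_rcons mem_head.
by rewrite XY0.
Qed.

(** Spelling every syllable as a reduced word over [X] or [Y] gives a reduced word over the union,
    because letters meeting at a seam belong to disjoint sets. *)
Lemma free_product_generated X Y : X `&` Y = set0 -> free_basis (X `|` Y) ->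
  free_product setT (generated X) (generated Y).
Proof.
move=> XY0 /free_basisP[gXY iXY].
have [sX sY] := (subgroup_generated X, subgroup_generated Y).
apply: free_productI => // [v rv ev|x].
  (* The first letter of [w] is kept on the side of the first syllable, so that the next syllable
     can be prepended without cancellation. *)
  suff [w [rw ew]] : exists w, [/\ reduced_word (X `|` Y) w, wprod w = sprod v &
      match v, w with
      | [::], [::] => True
      | a :: _, u :: _ => (if a.1 then Y else X) u.2
      | _, _ => False
      end].
    rewrite ev in ew; rewrite (iXY _ rw ew).
    by case: (v).
  elim: v rv {ev} => [|[s x] v IH]; first by exists [::]; rewrite sprod_nil wprod_nil.
  move=> /reduced_product_cons[/= x1 gx av /IH[w [rw ew hw]]].
  have [p [rp ep]] : exists p, reduced_word (if s then Y else X) p /\ wprod p = x.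
    by rewrite /syllable /= in gx; case: (s) gx => -[q /reduction_id[p rp <-] <-]; exists p.
  have [a [q epq]] : exists a q, p = a :: q.
    by case: (p) ep => [|a q _]; [rewrite wprod_nil => /esym | exists a, q].
  exists (p ++ w); rewrite wprod_cat sprod_cons ep ew; split=> //; last first.
    by rewrite epq /=; have [op _] := rp; apply: op; rewrite epq mem_head.
  case: v {IH ew} av hw => [_|[s' y] v /= ss'].
    case: w rw => // _ _; rewrite cats0; have [op sp] := rp; split=> //.
    by move=> u /op; case: (s); [right | left].
  case: w rw => // u w rw; case: s s' ss' rp {gx} => [] [] // _ rp hu.
    rewrite setUC; apply: reduced_word_cat; rewrite 1?setIC 1?setUC //.
  exact: reduced_word_cat.
have [w ow <-] : generated (X `|` Y) x by rewrite gXY.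
elim: w ow => [|u w IH]; first by exists [::]; rewrite // sprod_nil wprod_nil.
move=> /over_cons[XYu /IH[v hv ev]].
have side b : (if b then Y else X) u.2 -> syllable (generated X) (generated Y) (b, letter u).
  have H Z : Z u.2 -> generated Z (letter u).
    move=> Zu; exists [:: u]; last by rewrite wprod_cons wprod_nil mulg1.
    by move=> a; rewrite inE => /eqP->.
  by case: b; exact: H.
have [b Zu] : exists b : bool, (if b then Y else X) u.2.
  by case: XYu => ?; [exists false | exists true].
exists ((b, letter u) :: v); last by rewrite sprod_cons wprod_cons ev.
by move=> a; rewrite inE => /predU1P[->|/hv //]; exact: side.
Qed.

(* The free basis splits into [b_i = h (false, i)] and [c_i = h (true, i)]; [tau]
   exchanges [b_i] and [c_i], and [rho] maps [b_i] to [b_i c_i]. *)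
Lemma coding_exists (B : set F) : infinite_set B -> free_basis B ->
  exists (rho tau : Aut F) (A C : set F), coding rho tau A C /\ free_product setT C A.
Proof.
move=> infB fB; have [h [hB hI hS]] := infinite_set_double infB.
have /choice[k kP] (y : F) : exists p : bool * F, B y -> B p.2 /\ h p = y.
  have [By|nBy] := pselect (B y); last by exists (true, y).
  by have [p [_ Bp] hp] := hS y By; exists p.
have hk s x : B x -> k (h (s, x)) = (s, x).
  move=> Bx; have Bh : B (h (s, x)) by apply: hB.
  by have [Bk ek] := kP _ Bh; apply: hI; rewrite ?inE //; split.
have Bh s x : B x -> B (h (s, x)) by move=> Bx; apply: hB.
pose Z s : set F := [set y | B y /\ (k y).1 = s].
have hZ s x : B x -> Z s (h (s, x)) by move=> Bx; split; [exact: Bh | rewrite hk].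
have ZE s y : Z s y -> exists2 x, B x & y = h (s, x).
  by move=> [By <-]; have [? ?] := kP y By; exists (k y).2; rewrite -?surjective_pairing.
have BE : B = Z false `|` Z true.
  apply/seteqP; split=> [y By|y [] []] //.
  by case e : (k y).1; [right | left].
have Z0 : Z false `&` Z true = set0.
  by rewrite -subset0 => y [[_ e1] [_]]; rewrite e1.
have [gB iB] := (free_basisP B).1 fB.
have fp : free_product setT (generated (Z false)) (generated (Z true)).
  by apply: free_product_generated => //; rewrite -BE.
have fp' : free_product setT (generated (Z true)) (generated (Z false)).
  by apply: free_product_generated; rewrite 1?setIC // setUC -BE.
have subZ s : Z s `<=` B by move=> y [].
pose flip y := h (~~ (k y).1, (k y).2).
have flipP y : B y -> B (flip y) /\ flip (flip y) = y.
  move=> By; have [Bk ek] := kP y By; split; first exact: Bh.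
  by rewrite /flip hk //= negbK -surjective_pairing.
have [tau tauE] := free_basis_bij fB fB flipP flipP.
have tauZ : tau @` Z false = Z true.
  apply/seteqP; split=> [_ [y /ZE[x Bx ->] <-]|y /ZE[x Bx ->]].
    by rewrite /= tauE ?/flip ?hk //=; [exact: hZ | exact: Bh].
  exists (h (false, x)); first exact: hZ.
  by rewrite /= tauE ?/flip ?hk //; exact: Bh.
(* Trivial on the [c_i] and sending [b_i] to [c_i], so that the shear by [t] is the desired
   [rho]. *)
pose t y := if (k y).1 then 1 else flip y.
have [|rho rhoE] := @free_basis_shear F B t fB.
  move=> y By; rewrite /t; case e: (k y).1.
    by case: (subgroup_generated [set y | B y /\ t y = 1]).
  apply: sub_generated; have [Bf _] := flipP y By; split=> //.
  by have [Bk _] := kP y By; rewrite /t /flip hk // e.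
exists rho, tau, (generated (Z false)), (generated (Z true)); split=> //.
have tauA : tau @` generated (Z false) = generated (Z true).
  by rewrite -tauZ generated_image //; exact: aut_morph.
(* [comultiplication_primitive] excludes group-like elements other than the [b_i]. *)
have GE : grouplike rho tau (generated (Z false)) = Z false.
  have rhoZ d : Z false d -> rho d = d * tau d.
    by move=> [Bd kd]; rewrite rhoE // tauE // /t kd.
  apply/seteqP; split=> [x [gx [x1 rx]]|x Zx].
    apply: (comultiplication_primitive fp (aut_morph rho) (aut_morph tau)) gx x1 rx => //.
    - exact: aut_inj.
    - by move=> y gy; rewrite -tauA; exists y.
    - exact: sub_generated.
    - by move=> d /subZ; exact: independent_neq1.
  split; first exact: sub_generated.
  by split; [exact: (independent_neq1 iB (subZ _ _ Zx)) | exact: rhoZ].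
split=> // x [w ow ew].
have /infiniteP/pcard_leP[i] := infB.
have iB' n : B (i n) by apply: funS.
(* Distinct elements among the [c_i], serving as places where the prefixes of [w] are stored. *)
pose e n := h (true, i n).
have Ze n : Z true (e n) by apply: hZ.
have eI : injective e.
  move=> n m /(congr1 k); rewrite /e !hk // => -[]; apply: inj; rewrite ?inE //.
have /choice[idx idxP] (y : F) : exists o : option nat, forall n, o = Some n <-> y = e n.
  have [[n ->]|no] := pselect (exists n, y = e n).
    by exists (Some n) => m; split=> [[->//]|/eI->].
  by exists None => n; split=> // ye; case: no; exists n.
have idxe n : idx (e n) = Some n by apply/idxP.
have [t0 Zt0] : Z false !=set0 by exists (h (false, i 0%N)); exact: hZ.
have idxZ y : Z false y -> idx y = None.
  case ey: (idx y) => [n|//] Zy; move/idxP: ey => ey.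
  suff : (Z false `&` Z true) y by rewrite Z0.
  by split; rewrite // ey.
pose coded (s : nat -> F) y := if idx y is Some n then s n else 1.
have shear (s : nat -> F) : (forall n, generated (Z false) (s n)) ->
    exists g : Aut F, forall y, B y -> g y = y * coded s y.
  move=> gs; apply: free_basis_shear => // y By.
  have sub : Z false `<=` [set y | B y /\ coded s y = 1].
    by move=> z Zz; split; [exact: subZ Zz | rewrite /coded idxZ].
  have sg := subgroup_generated [set y | B y /\ coded s y = 1].
  rewrite {2}/coded; case: (idx y) => [n|]; last by case: sg.
  apply: (generated_sub sg _ (gs n)); apply: subset_trans sub _; exact: sub_generated.
have [gA1 gAM gAV] := subgroup_generated (Z false).
(* Labels [t0 ^+ (2 ^ n)]: the exponent is never 0, so no label is trivial, and each label is the
   square of the preceding one. *)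
have [|lam lamE] := shear (fun n => t0 ^+ (2 ^ n)).
  move=> n; elim: (2 ^ n)%N => [|m IH]; rewrite ?expg0 // expgS.
  by apply: gAM => //; exact: sub_generated.
(* The value at [e n] is the prefix of length [n], and 1 once [n] exceeds the length of [w], so that
   the chain condition holds there at once. *)
pose pre n := if (n <= size w)%N then wprod (take n w) else 1.
have [|psi psiE] := shear pre.
  move=> n; rewrite /pre; case: ifP => // _; exists (take n w) => // u /mem_take; exact: ow.
have lame n : lam (e n) = e n * t0 ^+ (2 ^ n).
  by rewrite lamE ?/coded ?idxe //; exact: subZ (Ze n).
have psie n : psi (e n) = e n * pre n.
  by rewrite psiE ?/coded ?idxe //; exact: subZ (Ze n).
have me n : marked rho tau (generated (Z false)) lam (e n).
  split.
    have : (tau @` Z false) (e n) by rewrite tauZ.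
    by rewrite GE => -[d Zd <-]; exists d.
  rewrite lame -[X in _ <> X]mulg1 => /mulgI/(independent_expg iB (subZ _ _ Zt0))/eqP.
  by rewrite expn_eq0.
exists lam, psi; split; last first.
  by exists (e (size w)); split=> //; rewrite psie /pre leqnn take_size ew.
move=> y [[d [Gd <-]] ly]; rewrite GE in Gd.
have Bd : B (tau d) by apply: (subZ true); rewrite -tauZ; exists d.
case ed: (idx (tau d)) => [n|]; last by case: ly; rewrite lamE // /coded ed mulg1.
move/idxP: ed => ed; rewrite ed psie.
case: n ed => [|n] ed; first by left; rewrite /pre take0 wprod_nil mulg1.
have [lt_nw|le_wn] := ltnP n (size w); last by left; rewrite /pre leqNgt ltnS le_wn mulg1.
right; exists (e n); split=> //.
pose u := nth (true, 1) w n.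
have Zu : Z false u.2 by apply: ow; exact: mem_nth.
exists (t0 ^+ (2 ^ n)), (pre n), (pre n.+1), u.2; split.
- exact: lame.
- by rewrite lame -expgnDr addnn -mul2n -expnS.
- exact: psie.
- exact: psie.
rewrite GE; split=> //; rewrite /pre lt_nw (ltnW lt_nw) (take_nth (true, 1)) // -cats1.
rewrite wprod_cat wprod_cons wprod_nil mulg1 -/u /letter.
(* A positive letter multiplies the shorter prefix; for a negative one, multiplying the longer
   prefix by the generator gives the shorter back. *)
by case: u.1; [right; rewrite mulgVK | left].
Qed.

End Existence.

(** * First-order formulas *)

Fixpoint lift_var (S : Type) (ts : seq S) (l : seq S) (s : S) (v : var l s) :
    var (ts ++ l) s :=
  if ts is t :: ts' then VS t (lift_var ts' v) else v.

Section Formulas.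
Local Notation fml := (@formula fsig).
Local Notation elt l := (var l FElt).
Local Notation aut l := (var l FAut).
Local Notation fac l := (var l FFac).
Local Notation E := FElt.
Local Notation Ex_elt p := (@Ex fsig _ FElt p).
Local Notation Ex_aut p := (@Ex fsig _ FAut p).
Local Notation Ex_fac p := (@Ex fsig _ FFac p).
Local Notation All_elt p := (@All fsig _ FElt p).

Definition f_act l (f : aut l) (x y : elt l) : fml l :=
  @Rel fsig l FActElt (f, (x, (y, tt))).

Definition f_mul l (x y z : elt l) : fml l :=
  @Rel fsig l FMul (x, (y, (z, tt))).

Definition f_one l (x : elt l) : fml l := @Rel fsig l FOne (x, tt).

Definition f_mem l (x : elt l) (A : fac l) : fml l :=
  @Rel fsig l FMem (x, (A, tt)).

Definition f_shift l (f : aut l) (e x : elt l) : fml l :=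
  Ex_elt (And (f_act (VS E f) (VS E e) (VZ l E))
                   (f_mul (VS E e) (VS E x) (VZ l E))).

Definition f_grouplike l (rho tau : aut l) (A : fac l) (d : elt l) : fml l :=
  And (f_mem d A) (And (Not (f_one d))
    (Ex_elt (And (f_act (VS E tau) (VS E d) (VZ l E))
                      (f_shift (VS E rho) (VS E d) (VZ l E))))).

Definition f_basis l (rho tau : aut l) (A : fac l) (x : elt l) : fml l :=
  Or (f_grouplike rho tau A x)
     (Ex_elt (And (f_grouplike (VS E rho) (VS E tau) (VS E A) (VZ l E))
                       (f_act (VS E tau) (VZ l E) (VS E x)))).

Definition f_marked l (rho tau : aut l) (A : fac l) (lam : aut l) (e : elt l) : fml l :=
  And (Ex_elt (And (f_grouplike (VS E rho) (VS E tau) (VS E A) (VZ l E))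
                        (f_act (VS E tau) (VZ l E) (VS E e))))
      (Not (f_act lam e e)).

Definition f_shift2 l (f : aut l) (e x : elt l) : fml l :=
  Ex_elt (And (f_mul (VS E x) (VS E x) (VZ l E))
                   (f_shift (VS E f) (VS E e) (VZ l E))).

(** The quantifiers bind [y], [z], [z'], [d] in this order, so [d] is innermost, and [up] lifts the
    outer variables past all four. *)
Definition f_step l (rho tau : aut l) (A : fac l) (lam psi : aut l) (e e' : elt l) : fml l :=
  let l4 := [:: E; E; E; E] in
  let up s (v : var l s) := lift_var l4 v in
  let d := VZ [:: E, E, E & l] E in
  let z' := VS E (VZ [:: E, E & l] E) in
  let z := lift_var [:: E; E] (VZ (E :: l) E) in
  let y := lift_var [:: E; E; E] (VZ l E) in
  Ex_elt (Ex_elt (Ex_elt (Ex_elt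
    (And (f_shift (up _ lam) (up _ e') y)
    (And (f_shift2 (up _ lam) (up _ e) y)
    (And (f_shift (up _ psi) (up _ e') z)
    (And (f_shift (up _ psi) (up _ e) z')
    (And (f_grouplike (up _ rho) (up _ tau) (up _ A) d)
         (Or (f_mul z d z') (f_mul z' d z)))))))))).

Definition f_chain l (rho tau : aut l) (A : fac l) (lam psi : aut l) : fml l :=
  let e := VZ l E in let e' := VZ (E :: l) E in
  All_elt (Imp (f_marked (VS E rho) (VS E tau) (VS E A) (VS E lam) e)
    (Or (f_act (VS E psi) e e)
      (Ex_elt (And
        (f_marked (lift_var [:: E; E] rho) (lift_var [:: E; E] tau) (lift_var [:: E; E] A)
          (lift_var [:: E; E] lam) e')
        (f_step (lift_var [:: E; E] rho) (lift_var [:: E; E] tau) (lift_var [:: E; E] A)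
          (lift_var [:: E; E] lam) (lift_var [:: E; E] psi) (VS E e) e'))))).

(** The whole group is not a constant of the structure, so it is named by quantifying over a free
    factor that contains every element. *)
Definition f_coding l (rho tau : aut l) (A C : fac l) : fml l :=
  And (Ex_fac (And
         (All_elt (f_mem (VZ _ E) (VS E (VZ l FFac))))
         (@Rel fsig (FFac :: l) FFreeProd (VZ l FFac, (VS FFac A, (VS FFac C, tt))))))
  (And (@Rel fsig l FActFac (tau, (A, (C, tt))))
       (All_elt (Imp (f_mem (VZ l E) (VS E A))
         (Ex_aut (Ex_aut
           (let up s (v : var l s) := lift_var [:: FAut; FAut; E] v in
            let psi := VZ [:: FAut, E & l] FAut in
            let lam := VS FAut (VZ (E :: l) FAut) in
            And (f_chain (up _ rho) (up _ tau) (up _ A) lam psi)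
            (Ex_elt (And
              (f_marked (VS E (up _ rho)) (VS E (up _ tau)) (VS E (up _ A)) (VS E lam)
                 (VZ [:: FAut, FAut, E & l] E))
              (f_shift (VS E psi) (VZ _ E) (lift_var [:: E; FAut; FAut] (VZ l E))))))))))).

Variable F : groupType.
Local Notation M := (fstructure F).
Implicit Types (l : seq fsort).

Definition aut_at l (v : aut l) (env : stuple M l) : Aut F := lookup v env.
Definition elt_at l (v : elt l) (env : stuple M l) : F := lookup v env.
Definition fac_at l (v : fac l) (env : stuple M l) : set F := sval (lookup v env : FreeFactors F).

Lemma sat_shift l (f : aut l) (e x : elt l) (env : stuple M l) :
  sat (f_shift f e x) env <-> aut_at f env (elt_at e env) = elt_at e env * elt_at x env.
Proof. split=> [[y [fe ex]]|fe]; first exact: (etrans fe (esym ex)).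
by exists (elt_at e env * elt_at x env). Qed.

Lemma sat_shift2 l (f : aut l) (e x : elt l) (env : stuple M l) :
  sat (f_shift2 f e x) env <->
  aut_at f env (elt_at e env) = elt_at e env * (elt_at x env * elt_at x env).
Proof.
split=> [[y [xx /sat_shift fe]]|h].
  exact: (etrans fe (congr1 _ (esym xx))).
by exists (elt_at x env * elt_at x env); split=> //; apply/sat_shift.
Qed.

Lemma sat_grouplike l (rho tau : aut l) (A : fac l) (d : elt l) (env : stuple M l) :
  sat (f_grouplike rho tau A d) env <->
  grouplike (aut_at rho env) (aut_at tau env) (fac_at A env) (elt_at d env).
Proof.
split=> [[Ad [d1 [y [td /sat_shift rd]]]]|[Ad [d1 rd]]].
  by do 2!split=> //; apply: (etrans rd); congr (_ * _); exact: esym.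
by do 2!split=> //; exists (aut_at tau env (elt_at d env)); split=> //; apply/sat_shift.
Qed.

Lemma sat_basis l (rho tau : aut l) (A : fac l) (x : elt l) (env : stuple M l) :
  sat (f_basis rho tau A x) env <->
  coded_basis (aut_at rho env) (aut_at tau env) (fac_at A env) (elt_at x env).
Proof.
split=> [[/sat_grouplike|[d [/sat_grouplike Gd dx]]]|[Gx|[d Gd dx]]].
- by left.
- by right; exists d.
- by left; apply/sat_grouplike.
- by right; exists d; split=> //; apply/sat_grouplike.
Qed.

Lemma sat_marked l (rho tau : aut l) (A : fac l) (lam : aut l) (e : elt l) (env : stuple M l) :
  sat (f_marked rho tau A lam e) env <->
  marked (aut_at rho env) (aut_at tau env) (fac_at A env) (aut_at lam env) (elt_at e env).
Proof.
split=> [[[d [/sat_grouplike Gd de]] le]|[[d [Gd de]] le]].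
  by split=> //; exists d.
by split=> //; exists d; split=> //; apply/sat_grouplike.
Qed.

Lemma sat_step l (rho tau : aut l) (A : fac l) (lam psi : aut l) (e e' : elt l)
    (env : stuple M l) :
  sat (f_step rho tau A lam psi e e') env <->
  prefix_step (aut_at rho env) (aut_at tau env) (fac_at A env) (aut_at lam env)
    (aut_at psi env) (elt_at e env) (elt_at e' env).
Proof.
split=> -[y [z [z' [d]]]].
  move=> [/sat_shift ? [/sat_shift2 ? [/sat_shift ? [/sat_shift ? [/sat_grouplike ? ?]]]]].
  by exists y, z, z', d.
move=> [? ? ? ? [? ?]]; exists y, z, z', d.
split; first exact/sat_shift.
split; first exact/sat_shift2.
do 2!(split; first exact/sat_shift).
by split; first exact/sat_grouplike.
Qed.

Lemma sat_chain l (rho tau : aut l) (A : fac l) (lam psi : aut l) (env : stuple M l) :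
  sat (f_chain rho tau A lam psi) env <->
  prefix_chain (aut_at rho env) (aut_at tau env) (fac_at A env) (aut_at lam env)
    (aut_at psi env).
Proof.
split=> ch; last first.
  hnf=> e /sat_marked/(ch e)[pe|[e' [me' st]]]; first by left.
  by right; exists e'; split; [apply/sat_marked | apply/sat_step].
move=> e me; have [|pe|[e' [/sat_marked me' /sat_step st]]] := ch e; first exact/sat_marked.
  by left.
by right; exists e'.
Qed.

(** Supplies the witness for the whole group in [f_coding]. With a trivial second factor, a reduced
    product has at most one syllable. *)
Lemma free_factor_setT : free_factor [set: F].
Proof.
exists [set 1]; apply: free_productI => // [|v [hv sv]|x]; last first.
- by exists [:: (false, x)]; [move=> a; rewrite inE => /eqP-> | rewrite sprod_cons sprod_nil mulg1].
- have side a : a \in v -> a.1 = false.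
    by move=> /hv[a1]; case: a.1.
  case: v sv hv side => [|a [|b v]] //= sv hv side.
    rewrite sprod_cons sprod_nil mulg1 => a1.
    by have [] := hv a (mem_head _ _).
  by rewrite !side ?inE ?eqxx ?orbT in sv.
- by split=> [|x y -> ->|x ->]; rewrite /= ?mulg1 ?invg1.
Qed.

Lemma sat_coding l (rho tau : aut l) (A C : fac l) (env : stuple M l) :
  sat (f_coding rho tau A C) env <->
  coding (aut_at rho env) (aut_at tau env) (fac_at A env) (fac_at C env).
Proof.
split=> [[[U [UT UAC]] [tA ch]]|[AC tA ch]].
  split=> // [|x Ax].
    have <- : sval (U : FreeFactors F) = setT by rewrite -subTset => x _; exact: UT.
    exact: UAC.
  have [lam [psi [/sat_chain cl [e [/sat_marked me /sat_shift pe]]]]] := ch x Ax.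
  by exists lam, psi; split=> //; exists e.
split; first by exists (exist _ setT free_factor_setT).
split=> // x Ax; have [lam [psi [cl [e [me pe]]]]] := ch x Ax.
exists lam, psi; split; first exact/sat_chain.
by exists e; split; [apply/sat_marked | apply/sat_shift].
Qed.

End Formulas.

(** * The interpretation *)

Definition par_sorts : seq fsort := [:: FAut; FAut; FFac; FFac].

Definition dim_sorts (s : bsort) : seq fsort :=
  match s with BAut => [:: FAut] | BElt => [:: FElt] end.

(** A tautology as domain and equality as equivalence: both sorts are interpreted by themselves, and
    the parameters enter only through the basis predicate. *)
Definition dom_formula (s : bsort) : @formula fsig (dim_sorts s ++ par_sorts) :=
  match s with
  | BAut => @Eq fsig _ FAut (VZ _ _) (VZ _ _)
  | BElt => @Eq fsig _ FElt (VZ _ _) (VZ _ _)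
  end.

Definition eqv_formula (s : bsort) :
    @formula fsig (dim_sorts s ++ dim_sorts s ++ par_sorts) :=
  match s with
  | BAut => @Eq fsig _ FAut (VZ _ _) (VS _ (VZ _ _))
  | BElt => @Eq fsig _ FElt (VZ _ _) (VS _ (VZ _ _))
  end.

Definition rel_formula (r : brel) :
    @formula fsig (flatten (map dim_sorts (brel_arity r)) ++ par_sorts) :=
  match r with
  | BMulAut => @Rel fsig _ FMulAut
      (VZ _ FAut, (VS _ (VZ _ FAut), (VS _ (VS _ (VZ _ FAut)), tt)))
  | BOneAut => @Rel fsig _ FOneAut (VZ _ FAut, tt)
  | BInvAut => @Rel fsig _ FInvAut (VZ _ FAut, (VS _ (VZ _ FAut), tt))
  | BMul => @Rel fsig _ FMul
      (VZ _ FElt, (VS _ (VZ _ FElt), (VS _ (VS _ (VZ _ FElt)), tt)))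
  | BOne => @Rel fsig _ FOne (VZ _ FElt, tt)
  | BInv => @Rel fsig _ FInv (VZ _ FElt, (VS _ (VZ _ FElt), tt))
  | BActElt => @Rel fsig _ FActElt
      (VZ _ FAut, (VS _ (VZ _ FElt), (VS _ (VS _ (VZ _ FElt)), tt)))
  | BBasis => f_basis (VS _ (VZ _ FAut)) (VS _ (VS _ (VZ _ FAut)))
      (VS _ (VS _ (VS _ (VZ _ FFac)))) (VZ par_sorts FElt)
  end.

Definition basis_interpretation : interpretation fsig bsig :=
  @Interpretation fsig bsig par_sorts dim_sorts dom_formula eqv_formula rel_formula.

Definition coding_formula : @formula fsig par_sorts :=
  f_coding (VZ _ FAut) (VS _ (VZ _ FAut)) (VS _ (VS _ (VZ _ FFac)))
    (VS _ (VS _ (VS _ (VZ _ FFac)))).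

Lemma sval_inj (T : Type) (P : T -> Prop) : injective (@sval T P).
Proof. by move=> [x px] [y py] /= /(eq_exist px py). Qed.

Section Interpreted.
Variable F : groupType.
Local Notation M := (fstructure F : structure fsig).
Local Notation I := basis_interpretation.
Variables (rho tau : Aut F) (A C : FreeFactors F).

Let p : stuple M (i_par I) := (rho, (tau, (A, (C, tt)))).

Definition tup_val (s : bsort) : itup I M s -> bcarrier F s :=
  match s with BAut => fun x => x.1 | BElt => fun x => x.1 end.

Definition val_tup (s : bsort) : bcarrier F s -> itup I M s :=
  match s with BAut => fun x => (x, tt) | BElt => fun x => (x, tt) end.

Lemma val_tupK s : cancel (@val_tup s) (@tup_val s). Proof. by case: s. Qed.

Lemma in_domT s (x : itup I M s) : in_dom p x.
Proof. by case: s x. Qed.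

Lemma in_eqvE s (x y : itup I M s) : in_eqv p x y <-> tup_val x = tup_val y.
Proof. by case: s x y. Qed.

Lemma in_relE (r : brel) (x : stuple (itup I M) (brel_arity r)) :
  in_rel p (r := r) x <->
  binterp (coded_basis rho tau (sval A)) (stuple_map tup_val x).
Proof.
case: r x => //=.
move=> [[x []] []]; exact: sat_basis.
Qed.

Lemma interpretation_well_defined : well_defined (I := I) p.
Proof.
split=> [s x _|s x y _ _|s x y z _ _ _|r x y _ _].
- exact/in_eqvE.
- by move=> /in_eqvE e; apply/in_eqvE.
- by move=> /in_eqvE e /in_eqvE e'; apply/in_eqvE; rewrite e.
move=> xy; suff e : stuple_map tup_val x = stuple_map tup_val y.
  by split=> /in_relE H; apply/in_relE; [rewrite -e | rewrite e].
by elim: (arity r) x y xy => [[] []|s l IH [x xs] [y ys] /= [/in_eqvE-> /IH ->]].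
Qed.

Definition class_rep s (c : quotient (I := I) p s) : itup I M s :=
  sval (cid2 (svalP c)).

Lemma class_repP s (c : quotient (I := I) p s) y :
  sval c y <-> tup_val y = tup_val (class_rep c).
Proof.
rewrite /class_rep; case: cid2 => x /= _ ->; split=> [[_ /in_eqvE]|e] //.
by split; [exact: in_domT | apply/in_eqvE].
Qed.

Definition class_val s (c : quotient (I := I) p s) : bcarrier F s :=
  tup_val (class_rep c).

Lemma class_val_bij s : bijective (@class_val s).
Proof.
pose q (v : bcarrier F s) : quotient (I := I) p s :=
  exist _ (eqv_class p (val_tup v)) (ex_intro2 _ _ _ (in_domT (val_tup v)) erefl).
exists q => [c|v].
  apply: sval_inj; apply/seteqP; split=> y.
    by move=> [_ /in_eqvE]; rewrite val_tupK => e; apply/class_repP.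
  by move=> /class_repP e; split; [exact: in_domT | apply/in_eqvE; rewrite val_tupK].
have : sval (q v) (class_rep (q v)) by apply/class_repP.
by move=> [_ /in_eqvE]; rewrite val_tupK.
Qed.

(** Every class is a singleton, and [class_val] reads off its element. *)
Lemma interpreted_iso :
  isomorphic (interpreted (I := I) p) (bstructure (coded_basis rho tau (sval A))).
Proof.
exists class_val; first exact: class_val_bij.
move=> r c; split=> [[x xc /in_relE]|H].
  suff -> : stuple_map tup_val x = stuple_map class_val c by [].
  by elim: (arity r) x c xc => [[] []|s l IH [x xs] [c cs] /= [/class_repP-> /IH->]].
exists (stuple_map class_rep c).
  by elim: (arity r) c {H} => //= s l IH [c cs]; split=> //=; apply/class_repP.
apply/in_relE; suff -> : stuple_map tup_val (stuple_map class_rep c) = stuple_map class_val c by [].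
by elim: (arity r) c {H} => //= s l IH [c cs] /=; rewrite IH.
Qed.

End Interpreted.

(** * Transport along automorphisms *)

Section Transport.
Variable F : groupType.
Implicit Types (f g : Aut F).

Lemma aut_ext f g : (forall x, f x = g x) -> f = g.
Proof. by move=> fg; apply: sval_inj; apply/funext. Qed.

Lemma aut_inverse g : exists2 g' : Aut F, cancel g g' & cancel g' g.
Proof.
have [[g' gK g'K] gM] := svalP g.
suff ag : automorphism g' by exists (exist _ g' ag).
split; first by exists g.
by move=> x y; apply: (can_inj gK); rewrite gM !g'K.
Qed.

Lemma comp_automorphism f g : automorphism (f \o g).
Proof.
have [[fb _] [gb _]] := (svalP f, svalP g).
by split; [exact: bij_comp | move=> x y /=; rewrite !aut_morph].
Qed.

Definition aut_comp f g : Aut F := exist _ (f \o g) (comp_automorphism f g).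

(** Elements move by [g] and automorphisms by conjugation with [g]; the action is preserved since
    [conj f (g x) = g (f x)]. *)
Lemma bstructure_iso g (D : set F) : isomorphic (bstructure D) (bstructure (g @` D)).
Proof.
have [g' gK g'K] := aut_inverse g.
have gM := aut_morph g; have [g1 gV] := morph_group1V gM.
pose conj (f : Aut F) := aut_comp g (aut_comp f g').
have conjE f x : conj f (g x) = g (f x) by rewrite /= /aut_fun /= [sval g' _]gK.
(* By surjectivity of [g], identities between conjugates need checking only at points [g x]. *)
have gS (P : F -> Prop) : (forall x, P (g x)) <-> forall x, P x.
  by split=> H x; [rewrite -(g'K x) | ]; apply: H.
exists (fun s => match s return bcarrier F s -> bcarrier F s with
  BAut => conj | BElt => g end).
  case; last by exists g'.
  exists (fun f => aut_comp g' (aut_comp f g)) => f; apply: aut_ext => x.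
    by rewrite /= /aut_fun /= ![sval g' _]gK.
  by rewrite /= /aut_fun /= ![sval g _]g'K.
have gI : injective g by exact: aut_inj.
case=> /=.
- move=> [f1 [f2 [f3 []]]] /=; split=> H; last first.
    by move=> x; apply: gI; rewrite -!conjE; apply: H.
  by apply/gS => x; rewrite !conjE H.
- move=> [f1 []] /=; split=> H; last by move=> x; apply: gI; rewrite -!conjE; apply: H.
  by apply/gS => x; rewrite !conjE H.
- move=> [f1 [f2 []]] /=; split=> H; last first.
    by move=> x; apply: gI; rewrite -!conjE; apply: H.
  by apply/gS => x; rewrite !conjE H.
- by move=> [x [y [z []]]] /=; rewrite /rel_mul -gM; split=> [->|/gI].
- by move=> [x []]; split=> [/= ->|gx1]; [exact: g1 | apply: gI; rewrite g1].
- by move=> [x [y []]] /=; rewrite /rel_inv -gV; split=> [->|/gI].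
- by move=> [f [x [y []]]] /=; rewrite /rel_act conjE; split=> [->|/gI].
move=> [x []] /=; split=> [Dx|[y Dy /gI <-] //]; by exists x.
Qed.

Lemma isomorphic_trans (L : signature) (M N P : structure L) :
  isomorphic M N -> isomorphic N P -> isomorphic M P.
Proof.
move=> [f fb fr] [g gb gr]; exists (fun s => g s \o f s) => [s|r x].
  exact: bij_comp.
rewrite fr gr; suff -> : stuple_map g (stuple_map f x) =
  stuple_map (fun s => g s \o f s) x by [].
by elim: (arity r) x => //= s l IH [x xs] /=; rewrite IH.
Qed.

End Transport.

Theorem theorem6p1 (F : groupType) (freeF : free_group F)
    (infF : infinitely_generated F) (B : set F) (basisB : free_basis B) :
  interpretable_with_definable_parameters (bstructure B) (fstructure F).
Proof.
exists basis_interpretation, coding_formula; split.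
  have [rho [tau [A [C [coded CA]]]]] := coding_exists (free_basis_infinite infF basisB) basisB.
  have [AC _ _] := coded.
  have fA : free_factor A by exists C.
  (* [C] is itself a parameter from the sort of free factors, which is why the decomposition with
     exchanged factors is also supplied. *)
  have fC : free_factor C by exists A.
  exists (rho, (tau, (exist _ A fA, (exist _ C fC, tt)))).
  exact/sat_coding.
move=> [rho [tau [A [C []]]]] /sat_coding coded.
split; first exact: interpretation_well_defined.
apply: isomorphic_trans (interpreted_iso _ _ _ _) _.
(* The coded basis varies with the parameters, but some automorphism always carries it onto [B]. *)
have [g <-] := free_basis_aut infF (coding_free_basis basisB coded) basisB.
exact: bstructure_iso.
Qed.
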